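(* Let $a_1,a_3\in\{1,-1\}$ and let $R_{\mathrm{no}}\subset(0,\infty)\times\mathbb{R}$ be the set of parameters $(\omega,\gamma)$ for which no standing wave profile exists, and $\Gamma_{\mathrm{no}}$ its boundary in $(0,\infty)\times\mathbb{R}$ (see context). Then: 1. (Case $a_1=a_3=1$.) $R_{\mathrm{no}}=\Gamma_{\mathrm{no}}$ is the curve given by $$\omega=\frac t3-\frac15t^3,\qquad \gamma=\frac{2}{3t}+\frac65t,\qquad 0<t\le\frac{\sqrt5}{3}.$$ Along it $(\omega,\gamma)\to(0,\infty)$ as $t\to0_+$, and $(\omega,\gamma)=\left(\frac{2\sqrt5}{27},\frac{4\sqrt5}{5}\right)$ at $t=\frac{\sqrt5}{3}$. 2. (Case $a_1=1$, $a_3=-1$.) $R_{\mathrm{no}}$ is the set of points on and above (in the $\gamma$ direction) the curve $\Gamma_{\mathrm{no}}$, which is given by $$\omega=\frac t3+\frac15t^3,\qquad \gamma=\frac{2}{3t}-\frac65t,\qquad 0<t<\infty.$$ Along it $(\omega,\gamma)\to(0,\infty)$ as $t\to0_+$ and $(\omega,\gamma)\to(\infty,-\infty)$ as $t\to\infty$. 3. (Case $a_1=-1$, $a_3=1$.) Both $R_{\mathrm{no}}$ and $\Gamma_{\mathrm{no}}$ are empty. 4. (Case $a_1=a_3=-1$.) $R_{\mathrm{no}}$ is the set of points on and above (in the $\gamma$ direction) the curve $\Gamma_{\mathrm{no}}$, which is given by $$\omega=-\frac t3+\frac15t^3,\qquad \gamma=-\frac{2}{3t}-\frac65t,\qquad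 \sqrt{\tfrac53}<t<\infty.$$ Along it $(\omega,\gamma)\to\left(0,-\frac{8\sqrt{15}}{15}\right)$ as $t\to\sqrt{5/3}_+$ and $(\omega,\gamma)\to(\infty,-\infty)$ as $t\to\infty$. Moreover, in cases 1, 2 and 4 the curve $\Gamma_{\mathrm{no}}$ has negative slope $d\gamma/d\omega<0$ everywhere on the curve.
   Context: For $a_1,a_3\in\{1,-1\}$, $\omega>0$, $\gamma\in\mathbb{R}$, set $f(s)=a_1|s|s-\gamma|s|^2s+a_3|s|^3s$, $g(s)=\omega s-f(s)$ and $G(x)=\int_0^xg(s)\,ds=\frac\omega2x^2-\frac{a_1}{3}|x|^3+\frac\gamma4x^4-\frac{a_3}{5}|x|^5$. A standing wave profile is a function $\phi\in C^2(\mathbb{R})$ with $\phi''=g(\phi)$ on $\mathbb{R}$, $\phi(t)>0$ for all $t\in\mathbb{R}$ and $\lim_{t\to\pm\infty}\phi(t)=0$. By a known criterion (Berestycki--Lions), a standing wave profile exists if and only if (E1) $G$ has a first (smallest) positive zero $\phi_0$, and (E2) $g(\phi_0)<0$. For fixed $(a_1,a_3)$, $R_{\mathrm{ex}}$ is the set of $(\omega,\gamma)\in(0,\infty)\times\mathbb{R}$ for which a standing wave profile exists (i.e. (E1) and (E2) both hold), $R_{\mathrm{no}}=((0,\infty)\times\mathbb{R})\setminus R_{\mathrm{ex}}$, and $\Gamma_{\mathrm{no}}$ is the boundary of $R_{\mathrm{no}}$ in $(0,\infty)\times\mathbb{R}$. At an endpoint of the curve belonging to it, the slope is understood as the one-sided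 slope along the curve. *)

(* Defs.v *)
From Stdlib Require Import Reals.
From Coquelicot Require Import Coquelicot.
Open Scope R_scope.

Definition f (a1 a3 gamma s : R) : R :=
  a1 * Rabs s * s - gamma * Rabs s ^ 2 * s + a3 * Rabs s ^ 3 * s.

Definition g (a1 a3 omega gamma s : R) : R := omega * s - f a1 a3 gamma s.

(* [ex_derive_n phi 2] alone would not entail differentiability of [phi],
   hence the two separate differentiability clauses. *)
Definition C2 (phi : R -> R) : Prop :=
  (forall t, ex_derive phi t) /\
  (forall t, ex_derive (Derive phi) t) /\
  (forall t, continuous (Derive (Derive phi)) t).

Definition standing_wave_profile (a1 a3 omega gamma : R) (phi : R -> R) : Prop :=
  C2 phi /\
  (forall t, Derive (Derive phi) t = g a1 a3 omega gamma (phi t)) /\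
  (forall t, 0 < phi t) /\
  is_lim phi p_infty 0 /\
  is_lim phi m_infty 0.

(* Points of the parameter plane are pairs (omega, gamma). *)
Definition half_plane (p : R * R) : Prop := 0 < fst p.

Definition R_ex (a1 a3 : R) (p : R * R) : Prop :=
  half_plane p /\
  exists phi : R -> R, standing_wave_profile a1 a3 (fst p) (snd p) phi.

Definition R_no (a1 a3 : R) (p : R * R) : Prop :=
  half_plane p /\ ~ R_ex a1 a3 p.

(* Boundary of A relative to the subspace X of the plane. *)
Definition boundary_in (X A : R * R -> Prop) (p : R * R) : Prop :=
  X p /\
  forall U : R * R -> Prop, locally p U ->
    (exists q, U q /\ X q /\ A q) /\ (exists q, U q /\ X q /\ ~ A q).

Definition Gamma_no (a1 a3 : R) : R * R -> Prop :=
  boundary_in half_plane (R_no a1 a3).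

Definition param_curve (om ga : R -> R) (D : R -> Prop) (p : R * R) : Prop :=
  exists t, D t /\ p = (om t, ga t).

Definition on_or_above (C : R * R -> Prop) (p : R * R) : Prop :=
  exists q, C q /\ fst q = fst p /\ snd q <= snd p.

(* Slope d gamma / d omega at p: the limit of the slopes of chords from p to
   other points q of C tending to p.  Only points of C are used, so at an
   endpoint of C this is the one-sided slope.  The second and third clauses
   exclude degenerate limits: p is not isolated in C, and the chords near p
   are not vertical (so the quotient is a genuine one). *)
Definition has_slope (C : R * R -> Prop) (p : R * R) (m : R) : Prop :=
  let along_C := within (fun q : R * R => C q /\ q <> p) (locally p) in
  C p /\
  (forall U : R * R -> Prop, locally p U -> exists q, U q /\ C q /\ q <> p) /\
  along_C (fun q => fst q <> fst p) /\
  filterlim (fun q : R * R => (snd q - snd p) / (fst q - fst p))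
    along_C (locally m).

Definition negative_slope (C : R * R -> Prop) : Prop :=
  forall p, C p -> exists m, m < 0 /\ has_slope C p m.

(* Main.v *)
(* Writing G x = x^2 P x with P a cubic ([Gquot]), (E1) and (E2) say that the
   first positive zero of P is a transversal one.  If it is, the first integral
   phi'^2 = 2 G(phi) becomes, after phi = x0 / cosh^2 z, a scalar equation
   z' = F z with F positive, bounded and continuous, solved by inverting the
   primitive of 1 / F.  Conversely a profile has zero energy, so its maximum M
   is a zero of P, and by Gronwall it never takes a value which is a double
   zero of P.  Hence nonexistence is governed by the double zeros t of P, and
   solving P t = P' t = 0 for (omega, gamma) gives the curve.  On it
   dgamma = - 2 / t^2 domega, which gives the slopes, including at the cusp. *)

Require Import Defs.
From Stdlib Require Import Reals Lra Psatz Classical Ranalysis5.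
From Stdlib Require Import FunctionalExtensionality PropExtensionality.
From Coquelicot Require Import Coquelicot.
Open Scope R_scope.

(** No existence criterion is assumed; both directions are proved directly. The obstacle to
    existence is that [phi' = - sqrt (2 * G phi)] is not Lipschitz at the turning value [x0], where
    the constant [x0] solves it too. The variable [z] removes this: [x0 - phi = x0 * tanh z ^ 2], so
    [sinh z] carries the sign change of [phi'], and the two tails of the profile sit at the two
    infinite ends of [z]. The sign of [a3] decides the shape of the nonexistence set. For [a3 = 1]
    the cubic P tends to minus infinity, so it always has a first positive zero and only a double
    one can obstruct: a curve at most. For [a3 = -1] it tends to plus infinity and may have no
    positive zero at all, which fills the region above the curve. For [a1 = a3 = 1] the curve stops
    where the third zero of P merges with the double one. This triple zero occurs at
    [t ^ 2 = 5 / 9], which is also where the derivatives of both coordinates vanish. *)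

Lemma is_derive_mvt (h dh : R -> R) (a b : R) :
  a < b -> (forall c, a <= c <= b -> is_derive h c (dh c)) ->
  exists c, a < c < b /\ h b - h a = dh c * (b - a).
Proof.
  intros Hab Hd.
  destruct (MVT_cor2 h dh a b Hab) as [c [H1 H2]].
  - intros c Hc. now apply is_derive_Reals, Hd.
  - now exists c.
Qed.

Lemma is_derive_continuity (h dh : R -> R) :
  (forall t, is_derive h t (dh t)) -> continuity h.
Proof.
  intros Hd t. apply derivable_continuous_pt. exists (dh t).
  now apply is_derive_Reals.
Qed.

(** * Scalar autonomous equations *)

(** Positivity of [F] replaces a Lipschitz condition, since the variables separate. The travel time
    [T] has derivative [/ F >= / K], hence is onto R, so its inverse is a global solution; as [T] is
    finite at every point, the solution passes every level in both directions. *)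
Lemma autonomous_flow (F : R -> R) (K : R) :
  (forall z, 0 < F z <= K) -> (forall z, continuous F z) ->
  exists z : R -> R,
    (forall t, is_derive z t (F (z t))) /\
    is_lim z p_infty p_infty /\ is_lim z m_infty m_infty.
Proof.
  intros HF HFc.
  assert (HK : 0 < K) by (specialize (HF 0); lra).
  assert (HFi : forall x, continuous (fun v => / F v) x).
  { intros x. apply continuous_comp. apply HFc.
    apply continuity_pt_filterlim. apply continuity_pt_inv.
    apply continuity_pt_id. unfold id. specialize (HF x). lra. }
  set (T := fun x => RInt (fun v => / F v) 0 x).
  assert (HT : forall x, is_derive T x (/ F x)).
  { intros x. apply (is_derive_RInt (fun v => / F v) T 0 x).
    - apply filter_forall. intros b.
      apply (RInt_correct (fun v => / F v)). apply ex_RInt_continuous. intros; apply HFi.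
    - apply HFi. }
  assert (HTc : continuity T) by (apply is_derive_continuity with (1 := HT)).
  assert (HTm : forall x y, x < y -> (y - x) / K <= T y - T x).
  { intros x y Hxy.
    destruct (is_derive_mvt T (fun x => / F x) x y Hxy) as [c [_ Hc]].
    { intros; apply HT. }
    rewrite Hc. unfold Rdiv. rewrite Rmult_comm.
    apply Rmult_le_compat_r; [lra|].
    apply Rinv_le_contravar; apply HF. }
  assert (HT0 : T 0 = 0) by apply (RInt_point 0 (fun v => / F v)).
  assert (HTs : forall t, {x | T x = t}).
  { intros t.
    destruct (IVT_gen T (- (K * (Rabs t + 1))) (K * (Rabs t + 1)) t HTc) as [x Hx].
    - assert (Hp := Rabs_pos t).
      assert (0 < K * (Rabs t + 1)) by nra.
      assert (H1 := HTm 0 (K * (Rabs t + 1)) H).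
      assert (H2 := HTm (- (K * (Rabs t + 1))) 0 ltac:(lra)).
      replace ((K * (Rabs t + 1) - 0) / K) with (Rabs t + 1) in H1 by (field; lra).
      replace ((0 - - (K * (Rabs t + 1))) / K) with (Rabs t + 1) in H2 by (field; lra).
      assert (Hl := Rle_abs t). assert (Hl' := Rle_abs (- t)).
      rewrite Rabs_Ropp in Hl'.
      split.
      + eapply Rle_trans. apply Rmin_l. lra.
      + eapply Rle_trans; [|apply Rmax_r]. lra.
    - exists x. apply Hx. }
  set (z := fun t => proj1_sig (HTs t)).
  assert (Hz : forall t, T (z t) = t) by (intros t; apply (proj2_sig (HTs t))).
  assert (Hlt : forall x t, T x < t -> x < z t).
  { intros x t Hx. destruct (Rlt_or_le x (z t)) as [h|h]; [exact h|].
    destruct h as [h|h].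
    - specialize (HTm _ _ h). rewrite Hz in HTm.
      assert (0 < (x - z t) / K) by (apply Rdiv_lt_0_compat; lra). lra.
    - rewrite <- h, Hz in Hx. lra. }
  assert (Hgt : forall x t, t < T x -> z t < x).
  { intros x t Hx. destruct (Rlt_or_le (z t) x) as [h|h]; [exact h|].
    destruct h as [h|h].
    - specialize (HTm _ _ h). rewrite Hz in HTm.
      assert (0 < (z t - x) / K) by (apply Rdiv_lt_0_compat; lra). lra.
    - rewrite h, Hz in Hx. lra. }
  exists z. split; [|split].
  - intros t. apply is_derive_Reals.
    assert (Hpr : forall a, derivable_pt T a).
    { intros a. exists (/ F a). now apply is_derive_Reals. }
    (* [T] stretches distances by at least [/ K], so its inverse is [K]-Lipschitz; the inverse
       function rule below asks for this continuity. *)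
    assert (Hzc : continuity_pt z t).
    { apply continuity_pt_filterlim, filterlim_locally. intros eps.
      assert (He := cond_pos eps).
      assert (L1 : 0 < eps / K) by (apply Rdiv_lt_0_compat; lra).
      exists (mkposreal _ L1). intros s Hs.
      change (Rabs (s - t) < eps / K) in Hs.
      change (Rabs (z s - z t) < eps).
      apply Rabs_def2 in Hs.
      assert (A1 := HTm (z t) (z t + eps) ltac:(lra)).
      assert (A2 := HTm (z t - eps) (z t) ltac:(lra)).
      rewrite Hz in A1, A2.
      replace (z t + eps - z t) with (pos eps) in A1 by ring.
      replace (z t - (z t - eps)) with (pos eps) in A2 by ring.
      apply Rabs_def1.
      - assert (z s < z t + eps) by (apply Hgt; lra). lra.
      - assert (z t - eps < z s) by (apply Hlt; lra). lra. }
    assert (Hmono : forall s1 s2, s1 < s2 -> z s1 <= z s2).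
    { intros s1 s2 Hs. apply Rlt_le, Hgt. now rewrite Hz. }
    assert (Hin : z (t - 1) <= z t <= z (t + 1)) by (split; apply Hmono; lra).
    assert (Hd : derive_pt T (z t) (Hpr (z t)) = / F (z t)).
    { apply derive_pt_eq_0. now apply is_derive_Reals. }
    assert (HFp := proj1 (HF (z t))).
    assert (L := derivable_pt_lim_recip_interv T z (t - 1) (t + 1) t
                   (fun a _ => Hpr a) Hzc ltac:(lra) ltac:(lra) Hin).
    simpl in L. rewrite Hd in L.
    replace (F (z t)) with (1 / / F (z t)) by (field; lra).
    apply L.
    + intros x _. apply Hz.
    + apply Rinv_neq_0_compat. lra.
  - apply is_lim_spec. intros M. exists (T M). intros t Ht. now apply Hlt.
  - apply is_lim_spec. intros M. exists (T M). intros t Ht. now apply Hgt.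
Qed.

(* [auto_derive] leaves derivatives of unknown functions in this expanded form. *)
Lemma Derive_eta (h : R -> R) (t l : R) :
  is_derive h t l -> Derive (fun x : R => h x) t = l.
Proof. apply is_derive_unique. Qed.

(** * Existence of a profile *)

(* [G x = x ^ 2 * Gquot x] for [x >= 0], so the positive zeros of [G] are those
   of [Gquot], and [g x = x ^ 2 * dGquot x] at such a zero. *)
Definition Gquot (a1 a3 om ga x : R) : R :=
  om / 2 - a1 / 3 * x + ga / 4 * x ^ 2 - a3 / 5 * x ^ 3.

Definition dGquot (a1 a3 om ga x : R) : R :=
  - a1 / 3 + ga / 2 * x - 3 * a3 / 5 * x ^ 2.

Lemma g_pos (a1 a3 om ga s : R) :
  0 < s -> g a1 a3 om ga s = om * s - a1 * s ^ 2 + ga * s ^ 3 - a3 * s ^ 4.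
Proof.
  intros Hs. unfold g, Defs.f. rewrite Rabs_pos_eq by lra. ring.
Qed.

Lemma standing_wave_profile_intro (a1 a3 om ga : R) (phi psi : R -> R) :
  (forall t, is_derive phi t (psi t)) ->
  (forall t, is_derive psi t (g a1 a3 om ga (phi t))) ->
  (forall t, 0 < phi t) ->
  is_lim phi p_infty 0 -> is_lim phi m_infty 0 ->
  standing_wave_profile a1 a3 om ga phi.
Proof.
  intros D1 D2 Hp L1 L2.
  assert (E1 : Derive phi = psi).
  { apply functional_extensionality. intros t. now apply is_derive_unique. }
  assert (E2 : Derive psi = fun t => om * phi t - a1 * phi t ^ 2
                            + ga * phi t ^ 3 - a3 * phi t ^ 4).
  { apply functional_extensionality. intros t.
    rewrite <- g_pos by apply Hp. now apply is_derive_unique. }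
  split; [split; [|split]|split; [|split; [|split]]]; auto.
  - intros t. now exists (psi t).
  - intros t. rewrite E1. eexists. apply D2.
  - intros t. rewrite E1, E2.
    apply (ex_derive_continuous (fun t => om * phi t - a1 * phi t ^ 2
                            + ga * phi t ^ 3 - a3 * phi t ^ 4)).
    assert (ex_derive phi t) by (now exists (psi t)).
    auto_derive. auto.
  - intros t. rewrite E1. now apply is_derive_unique.
Qed.

Lemma cosh_ge_abs (x : R) : 1 <= cosh x /\ Rabs x <= 2 * cosh x.
Proof.
  unfold cosh.
  assert (He : exp x * exp (- x) = 1) by (rewrite <- exp_plus, Rplus_opp_r; apply exp_0).
  assert (H1 := exp_pos x). assert (H2 := exp_pos (- x)).
  assert (H3 := exp_ineq1_le x). assert (H4 := exp_ineq1_le (- x)).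
  split; [nra|]. apply Rabs_le. lra.
Qed.

(* The substitution [phi = x0 / cosh z ^ 2] turns the first integral
   [phi' ^ 2 = 2 * G phi] into the regular equation
   [z' = sqrt x0 / 2 * sqrt (2 * Q phi)], where [Gquot s = (x0 - s) * Q s]. *)
Lemma profile_of_transversal_root (a1 a3 om ga x0 : R) :
  0 < x0 -> Gquot a1 a3 om ga x0 = 0 ->
  (forall x, 0 < x < x0 -> 0 < Gquot a1 a3 om ga x) ->
  dGquot a1 a3 om ga x0 < 0 ->
  exists phi, standing_wave_profile a1 a3 om ga phi.
Proof.
  intros Hx0 Hr Hpos Hd.
  (* Coefficients of the quotient of [Gquot] by [x0 - s]. Expressing the original parameters through
     them builds the condition [Gquot x0 = 0] into the notation. *)
  set (q2 := a3 / 5). set (q1 := x0 * q2 - ga / 4). set (q0 := x0 * q1 + a1 / 3).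
  assert (Ea3 : a3 = 5 * q2) by (unfold q2; lra).
  assert (Ega : ga = 4 * (x0 * q2 - q1)) by (unfold q1; lra).
  assert (Ea1 : a1 = 3 * (q0 - x0 * q1)) by (unfold q0; lra).
  assert (Eom : om = 2 * x0 * q0).
  { unfold Gquot in Hr. rewrite Ea1, Ea3, Ega in Hr. nra. }
  clearbody q0 q1 q2. subst a1 a3 ga om.
  set (Q := fun s => q0 + q1 * s + q2 * s ^ 2).
  assert (HQ : forall s, 0 < s <= x0 -> 0 < Q s).
  { intros s [Hs [Hs'|Hs']].
    - assert (Hp := Hpos s (conj Hs Hs')).
      replace (Gquot _ _ _ _ s) with ((x0 - s) * Q s) in Hp by (unfold Gquot, Q; field).
      apply Rmult_lt_reg_l with (x0 - s); lra.
    (* Transversality enters here: it keeps [Q] positive at [x0], the value reached at [z = 0],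
       where the speed of [z] would otherwise vanish. *)
    - subst s. replace (dGquot _ _ _ _ x0) with (- Q x0) in Hd by (unfold dGquot, Q; field). lra. }
  set (k := sqrt x0).
  assert (Hk : 0 < k) by (apply sqrt_lt_R0; lra).
  assert (Hkk : k * k = x0) by (apply sqrt_sqrt; lra).
  assert (Hphi : forall z, 0 < x0 / cosh z ^ 2 <= x0).
  { intros z. destruct (cosh_ge_abs z) as [Hc _].
    assert (1 <= cosh z ^ 2) by nra.
    split. apply Rdiv_lt_0_compat; lra.
    apply Rmult_le_reg_r with (cosh z ^ 2); [lra|].
    replace (x0 / cosh z ^ 2 * cosh z ^ 2) with x0 by (field; lra). nra. }
  set (F := fun z => k / 2 * sqrt (2 * Q (x0 / cosh z ^ 2))).
  set (B := Rabs q0 + Rabs q1 * x0 + Rabs q2 * x0 ^ 2).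
  assert (HB : forall s, 0 < s <= x0 -> Q s <= B).
  { intros s Hs. unfold Q, B.
    assert (A0 := Rle_abs q0). assert (A1 := Rle_abs q1). assert (A2 := Rle_abs q2).
    assert (P1 := Rabs_pos q1). assert (P2 := Rabs_pos q2).
    assert (s ^ 2 <= x0 ^ 2) by nra. assert (0 <= s ^ 2) by nra. nra. }
  destruct (autonomous_flow F (k / 2 * sqrt (2 * B))) as [z [Hz [Lp Lm]]].
  { intros z. unfold F. specialize (Hphi z). split.
    - apply Rmult_lt_0_compat; [lra|]. apply sqrt_lt_R0. specialize (HQ _ Hphi). lra.
    - apply Rmult_le_compat_l; [lra|]. apply sqrt_le_1_alt.
      specialize (HB _ Hphi). lra. }
  { intros z. apply (ex_derive_continuous F). unfold F, Q.
    assert (Dc : is_derive cosh z (sinh z))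
      by apply is_derive_Reals, derivable_pt_lim_cosh.
    destruct (cosh_ge_abs z) as [Hc _]. specialize (HQ _ (Hphi z)). unfold Q in HQ.
    assert (ex_derive cosh z) by (now exists (sinh z)).
    assert (cosh z * (cosh z * 1) <> 0) by nra.
    auto_derive. unfold Rdiv in HQ. simpl in HQ.
    repeat split; auto. lra. }
  set (c := fun t => cosh (z t)). set (s := fun t => sinh (z t)).
  set (phi := fun t => x0 / c t ^ 2).
  set (r := fun t => sqrt (2 * Q (phi t))).
  assert (Hz' : forall t, is_derive z t (k / 2 * r t)) by exact Hz.
  assert (Dc : forall t, is_derive c t (s t * (k / 2 * r t))).
  { intros t. unfold c. rewrite Rmult_comm.
    apply (is_derive_comp cosh z); [|apply Hz'].
    apply is_derive_Reals, derivable_pt_lim_cosh. }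
  assert (Ds : forall t, is_derive s t (c t * (k / 2 * r t))).
  { intros t. unfold s. rewrite Rmult_comm.
    apply (is_derive_comp sinh z); [|apply Hz'].
    apply is_derive_Reals, derivable_pt_lim_sinh. }
  assert (Hc1 : forall t, 1 <= c t) by (intros; apply cosh_ge_abs).
  assert (Hcz : forall t, Rabs (z t) <= 2 * c t) by (intros; apply cosh_ge_abs).
  assert (Hcs : forall t, s t * s t = c t * c t - 1).
  { intros t. unfold c, s, cosh, sinh.
    assert (He : exp (z t) * exp (- z t) = 1)
      by (rewrite <- exp_plus, Rplus_opp_r; apply exp_0).
    nra. }
  assert (Hph : forall t, 0 < phi t <= x0) by (intros; apply Hphi).
  assert (Hr0 : forall t, 0 < r t).
  { intros t. apply sqrt_lt_R0. specialize (HQ _ (Hph t)). lra. }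
  assert (Hrr : forall t, r t * r t = 2 * Q (phi t)).
  { intros t. apply sqrt_sqrt. specialize (HQ _ (Hph t)). lra. }
  assert (Dphi : forall t, is_derive phi t (- (x0 * k * s t * r t / c t ^ 3))).
  { intros t. specialize (Hc1 t). specialize (Dc t).
    assert (ex_derive c t) by (now eexists; apply Dc).
    unfold phi. auto_derive.
    - repeat split; auto. nra.
    - rewrite (Derive_eta _ _ _ Dc). field. lra. }
  assert (Dr : forall t, is_derive r t
     ((q1 + 2 * q2 * phi t) * (- (x0 * k * s t * r t / c t ^ 3)) / r t)).
  { intros t. specialize (Dphi t). specialize (HQ _ (Hph t)).
    specialize (Hr0 t). unfold Q in HQ.
    assert (ex_derive phi t) by (now eexists; apply Dphi).
    clearbody phi. unfold r, Q. auto_derive.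
    - repeat split; auto. lra.
    - rewrite (Derive_eta _ _ _ Dphi). simpl.
      change (sqrt (2 * (q0 + q1 * phi t + q2 * (phi t * (phi t * 1))))) with (r t).
      field. specialize (Hc1 t). lra. }
  assert (Dpsi : forall t, is_derive (fun t => - (x0 * k * s t * r t / c t ^ 3)) t
      (g (3 * (q0 - x0 * q1)) (5 * q2) (2 * x0 * q0) (4 * (x0 * q2 - q1)) (phi t))).
  { intros t. rewrite g_pos by apply Hph.
    specialize (Dr t). specialize (Ds t). specialize (Dc t). specialize (Hc1 t).
    specialize (Hr0 t). specialize (Hrr t). specialize (Hcs t).
    assert (ex_derive c t) by (now eexists; apply Dc).
    assert (ex_derive s t) by (now eexists; apply Ds).
    assert (ex_derive r t) by (now eexists; apply Dr).
    clearbody r s. auto_derive.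
    - repeat split; auto. simpl. apply Rmult_integral_contrapositive_currified; nra.
    - rewrite (Derive_eta _ _ _ Dc),
        (Derive_eta _ _ _ Ds),
        (Derive_eta _ _ _ Dr).
      (* Grouped so that [k], [s t] and [r t] occur only through their squares; replacing these
         leaves an identity between rational functions of [c t]. *)
      transitivity (- (x0 * (k * k) / 2 * (c t * c t - 3 * (s t * s t)) / c t ^ 4 * (r t * r t))
        + x0 ^ 2 * (k * k) * (s t * s t) * (q1 + 2 * q2 * phi t) / c t ^ 6).
      + unfold phi. field. lra.
      + rewrite Hkk, Hcs, Hrr. unfold Q, phi. field. lra. }
  (* Linear growth of cosh is enough: [Rabs (z t) <= 2 * c t] gives [c t > 2 * x0 / eps], and then
     [phi t <= x0 / c t < eps]. *)
  assert (Hlim : forall eps t, 0 < eps -> 4 * x0 / eps + 1 < Rabs (z t) ->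
                 Rabs (phi t - 0) < eps).
  { intros eps t He Ht. rewrite Rminus_0_r, Rabs_pos_eq by apply Rlt_le, Hph.
    specialize (Hcz t). specialize (Hc1 t).
    assert (0 < 4 * x0 / eps) by (apply Rdiv_lt_0_compat; lra).
    unfold phi. apply Rmult_lt_reg_r with (c t ^ 2); [nra|].
    replace (x0 / c t ^ 2 * c t ^ 2) with x0 by (field; lra).
    assert (A : 2 * x0 / eps < c t).
    { replace (2 * x0 / eps) with (4 * x0 / eps / 2) by (field; lra). lra. }
    apply Rmult_lt_compat_l with (r := eps) in A; [|lra].
    replace (eps * (2 * x0 / eps)) with (2 * x0) in A by (field; lra).
    assert (c t <= c t ^ 2) by nra. nra. }
  exists phi. apply standing_wave_profile_intro with (1 := Dphi) (2 := Dpsi).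
  - apply Hph.
  - apply is_lim_spec in Lp. apply is_lim_spec. intros eps.
    destruct (Lp (4 * x0 / eps + 1)) as [N HN]. exists N. intros t Ht.
    apply Hlim. apply cond_pos. apply Rlt_le_trans with (z t); [auto|apply Rle_abs].
  - apply is_lim_spec in Lm. apply is_lim_spec. intros eps.
    destruct (Lm (- (4 * x0 / eps + 1))) as [N HN]. exists N. intros t Ht.
    apply Hlim. apply cond_pos. specialize (HN t Ht).
    apply Rlt_le_trans with (- z t); [lra|]. rewrite <- Rabs_Ropp. apply Rle_abs.
Qed.

(** * Necessary condition *)

(** The equation makes [phi' ^ 2 - 2 * G phi] constant. A profile is only known to tend to 0 itself,
    with nothing said about [phi'], so the value of the constant has to be found along well chosen
    points. *)
Lemma profile_energy (a1 a3 om ga : R) (phi : R -> R) :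
  standing_wave_profile a1 a3 om ga phi ->
  forall t, Derive phi t ^ 2 = 2 * phi t ^ 2 * Gquot a1 a3 om ga (phi t).
Proof.
  intros [[C1 [C2 _]] [Hode [Hpos [Lp _]]]].
  set (E := fun t => Derive phi t ^ 2 - 2 * phi t ^ 2 * Gquot a1 a3 om ga (phi t)).
  assert (D1 : forall t, is_derive phi t (Derive phi t)) by (intros; now apply Derive_correct).
  assert (DE : forall t, is_derive E t 0).
  { intros t. unfold E, Gquot.
    set (psi := Derive phi) in *.
    assert (D2 : Derive psi t = om * phi t - a1 * phi t ^ 2 + ga * phi t ^ 3 - a3 * phi t ^ 4)
      by (rewrite Hode; apply g_pos, Hpos).
    specialize (D1 t). specialize (C1 t). specialize (C2 t).
    clearbody psi. auto_derive; [tauto|].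
    rewrite (Derive_eta _ _ _ D1), (Derive_eta psi t _ (Derive_correct _ _ C2)), D2.
    field. }
  assert (Econst : forall a b, a < b -> E a = E b).
  { intros a b Hab. apply eq_is_derive; [|exact Hab]. intros; apply DE. }
  (* The sum of the absolute coefficients bounds [Gquot] on (0, 1], whence the restriction
     [eps <= 1] below. *)
  set (K := Rabs om / 2 + Rabs a1 / 3 + Rabs ga / 4 + Rabs a3 / 5).
  assert (HK : 0 <= K).
  { unfold K. assert (A := Rabs_pos om). assert (A' := Rabs_pos a1).
    assert (A'' := Rabs_pos ga). assert (A3 := Rabs_pos a3). lra. }
  assert (HH : forall x, 0 < x <= 1 -> Rabs (Gquot a1 a3 om ga x) <= K).
  { intros x Hx. unfold Gquot, K.
    assert (B1 := proj1 (Rabs_le_between om _) (Rle_refl _)).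
    assert (B2 := proj1 (Rabs_le_between a1 _) (Rle_refl _)).
    assert (B3 := proj1 (Rabs_le_between ga _) (Rle_refl _)).
    assert (B4 := proj1 (Rabs_le_between a3 _) (Rle_refl _)).
    assert (0 <= x ^ 2 <= 1) by nra. assert (0 <= x ^ 3 <= 1) by nra.
    apply Rabs_le. split; nra. }
  (* By the mean value theorem [phi'] is small at points arbitrarily far out,
     so the constant energy vanishes. *)
  assert (Esmall : forall eps, 0 < eps <= 1 -> forall a, Rabs (E a) <= (1 + 2 * K) * eps).
  { intros eps He a. apply is_lim_spec in Lp.
    destruct (Lp (mkposreal eps (proj1 He))) as [N HN]. simpl in HN.
    set (n := Rmax N a + 1).
    assert (Hn : N < n /\ a < n).
    { unfold n. split; [apply Rle_lt_trans with (Rmax N a)|apply Rle_lt_trans with (Rmax N a)];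
      try apply Rmax_l; try apply Rmax_r; lra. }
    assert (Hsm : forall t, n <= t -> 0 < phi t < eps).
    { intros t Ht. specialize (HN t ltac:(lra)). specialize (Hpos t).
      rewrite Rminus_0_r, Rabs_pos_eq in HN; lra. }
    destruct (is_derive_mvt phi (Derive phi) n (n + 1)) as [c [Hc Ec]];
      [lra|intros; apply D1|].
    rewrite (Econst a c) by lra.
    assert (S1 := Hsm n ltac:(lra)). assert (S2 := Hsm (n + 1) ltac:(lra)).
    assert (S3 := Hsm c ltac:(lra)).
    assert (Dc : - eps < Derive phi c < eps) by lra.
    assert (Hc1 := HH (phi c) ltac:(lra)). apply Rabs_le_between in Hc1.
    unfold E. set (h := Gquot a1 a3 om ga (phi c)) in *.
    assert (0 <= Derive phi c ^ 2 <= eps) by nra.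
    assert (0 <= phi c ^ 2 <= eps) by nra.
    apply Rabs_le. split; nra. }
  intros t.
  assert (E t = 0); [|unfold E in *; lra].
  apply Rabs_eq_0. apply Rle_antisym; [|apply Rabs_pos].
  apply Rnot_lt_le. intros Hlt.
  set (y := Rabs (E t)) in *.
  assert (P : 0 < y / (2 * (1 + 2 * K))) by (apply Rdiv_lt_0_compat; lra).
  set (eps := Rmin 1 (y / (2 * (1 + 2 * K)))).
  assert (He : 0 < eps <= 1).
  { split; [apply Rmin_glb_lt; lra|apply Rmin_l]. }
  assert (S := Esmall eps He t). fold y in S.
  assert (eps <= y / (2 * (1 + 2 * K))) by apply Rmin_r.
  assert ((1 + 2 * K) * eps <= (1 + 2 * K) * (y / (2 * (1 + 2 * K))))
    by (apply Rmult_le_compat_l; lra).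
  replace ((1 + 2 * K) * (y / (2 * (1 + 2 * K)))) with (y / 2) in * by (field; lra).
  lra.
Qed.

(* Gronwall: [u ^ 2] times a decaying exponential is nonincreasing. *)
Lemma forward_uniqueness (u du : R -> R) (k t0 : R) :
  (forall t, is_derive u t (du t)) -> (forall t, du t ^ 2 <= k * u t ^ 2) ->
  u t0 = 0 -> forall t, t0 < t -> u t = 0.
Proof.
  intros Du Hdu H0 t Ht.
  destruct (is_derive_mvt (fun t => u t ^ 2 * exp (- ((1 + k) * t)))
    (fun t => (2 * u t * du t - (1 + k) * u t ^ 2) * exp (- ((1 + k) * t))) t0 t Ht)
    as [c [_ Hc]].
  { intros c _. specialize (Du c).
    assert (ex_derive u c) by (now eexists; apply Du).
    auto_derive; [auto|]. rewrite (Derive_eta _ _ _ Du). ring. }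
  rewrite H0 in Hc.
  assert (P1 := exp_pos (- ((1 + k) * c))).
  assert (P2 := exp_pos (- ((1 + k) * t))).
  specialize (Hdu c).
  assert (N : 2 * u c * du c - (1 + k) * u c ^ 2 <= 0).
  { assert (0 <= (u c - du c) ^ 2) by apply pow2_ge_0. nra. }
  assert (N2 : (2 * u c * du c - (1 + k) * u c ^ 2) * exp (- ((1 + k) * c)) <= 0) by nra.
  assert (N3 : u t ^ 2 * exp (- ((1 + k) * t)) <= 0) by nra.
  assert (u t ^ 2 <= 0) by nra. nra.
Qed.

(** [M] is the maximum of [phi], where [phi' = 0]. After its maximum the profile must descend
    through every level [x <= M]. At a double zero [x] the energy identity bounds [phi' ^ 2] by a
    multiple of [(phi - x) ^ 2], so [phi] would stay equal to [x] from then on and could not tend to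
    0. *)
Lemma profile_root (a1 a3 om ga : R) (phi : R -> R) :
  standing_wave_profile a1 a3 om ga phi ->
  exists M, 0 < M /\ Gquot a1 a3 om ga M = 0 /\
    forall x, 0 < x <= M -> Gquot a1 a3 om ga x = 0 -> dGquot a1 a3 om ga x <> 0.
Proof.
  intros Hsw. assert (En := profile_energy _ _ _ _ _ Hsw).
  destruct Hsw as [[C1 _] [_ [Hpos [Lp Lm]]]].
  assert (D1 : forall t, is_derive phi t (Derive phi t)) by (intros; now apply Derive_correct).
  assert (Hcont : continuity phi) by (apply is_derive_continuity with (1 := D1)).
  assert (Hsm : forall eps, 0 < eps -> exists N, 0 < N /\ forall t, N < t -> phi t < eps /\ phi (- t) < eps).
  { intros eps He. apply is_lim_spec in Lp. apply is_lim_spec in Lm.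
    destruct (Lp (mkposreal _ He)) as [N1 H1]. destruct (Lm (mkposreal _ He)) as [N2 H2].
    simpl in H1, H2.
    exists (1 + Rabs N1 + Rabs N2).
    assert (A1 := Rabs_pos N1). assert (A2 := Rabs_pos N2).
    assert (B1 := Rle_abs N1). assert (B2 := Rle_abs (- N2)). rewrite Rabs_Ropp in B2.
    split; [lra|]. intros t Ht.
    specialize (H1 t ltac:(lra)). specialize (H2 (- t) ltac:(lra)).
    rewrite Rminus_0_r in H1, H2. apply Rabs_def2 in H1. apply Rabs_def2 in H2. lra. }
  (* With the threshold [phi 0], values outside [-N, N] lie below [phi 0], so the maximum over this
     compact interval is global. *)
  destruct (Hsm (phi 0) (Hpos 0)) as [N [HN0 HN]].
  destruct (continuity_ab_maj phi (- N) N) as [t0 [Hmax Ht0]].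
  { lra. } { intros; apply Hcont. }
  assert (Hglob : forall t, phi t <= phi t0).
  { assert (phi 0 <= phi t0) by (apply Hmax; lra).
    intros t. destruct (Rle_or_lt (- N) t) as [h1|h1].
    - destruct (Rle_or_lt t N) as [h2|h2]; [now apply Hmax|].
      specialize (HN t h2). lra.
    - specialize (HN (- t) ltac:(lra)). rewrite Ropp_involutive in HN. lra. }
  set (M := phi t0).
  assert (HM : 0 < M) by apply Hpos.
  exists M. split; [exact HM|]. split.
  - assert (Hpr : derivable_pt phi t0) by (exists (Derive phi t0); now apply is_derive_Reals).
    assert (Z : Derive phi t0 = 0).
    { rewrite <- (Derive_Reals _ _ Hpr).
      apply deriv_maximum with (t0 - 1) (t0 + 1); try lra. intros; apply Hglob. }
    specialize (En t0). rewrite Z in En. fold M in En.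
    assert (0 < 2 * M ^ 2) by nra. nra.
  - intros x Hx Hroot Hdbl.
    destruct (Hsm x (proj1 Hx)) as [N' [_ HN']].
    set (t1 := Rmax N' t0 + 1).
    assert (Ht1 : N' < t1 /\ t0 < t1).
    { unfold t1. split; [apply Rle_lt_trans with (Rmax N' t0)|apply Rle_lt_trans with (Rmax N' t0)];
      try apply Rmax_l; try apply Rmax_r; lra. }
    destruct (HN' t1 (proj1 Ht1)) as [Hlow _].
    destruct (IVT_gen phi t0 t1 x Hcont) as [tau [Htau Etau]].
    { fold M. rewrite Rmin_right, Rmax_left; lra. }
    rewrite Rmin_left, Rmax_right in Htau by lra.
    (* Bounds [2 * phi ^ 2] times the cofactor of [(phi - x) ^ 2] in [Gquot]; the factor 3 comes
       from [phi t + 2 * x <= 3 * M]. *)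
    set (k := 2 * M ^ 2 * (Rabs ga / 4 + 3 * M * (Rabs a3 / 5))).
    assert (U : phi t1 - x = 0).
    { apply (forward_uniqueness (fun t => phi t - x) (Derive phi) k tau).
      - intros t. specialize (D1 t). auto_derive.
        + apply C1.
        + rewrite (Derive_eta _ _ _ D1). ring.
      - intros t. rewrite En.
        replace (Gquot a1 a3 om ga (phi t)) with
          ((phi t - x) ^ 2 * (ga / 4 - a3 / 5 * (phi t + 2 * x))).
        2:{ transitivity (Gquot a1 a3 om ga (phi t) - Gquot a1 a3 om ga x
                          - dGquot a1 a3 om ga x * (phi t - x)).
            - unfold Gquot, dGquot. field.
            - rewrite Hroot, Hdbl. ring. }
        assert (Hp := Hpos t). assert (Hg := Hglob t). fold M in Hg.
        assert (Bg := Rle_abs ga).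
        assert (Ba := proj1 (Rabs_le_between a3 _) (Rle_refl _)).
        assert (T1 : ga / 4 - a3 / 5 * (phi t + 2 * x) <= Rabs ga / 4 + 3 * M * (Rabs a3 / 5)) by nra.
        assert (T2 : 0 <= Rabs ga / 4 + 3 * M * (Rabs a3 / 5)).
        { assert (A1 := Rabs_pos ga). assert (A2 := Rabs_pos a3). nra. }
        assert (T3 : 0 <= phi t ^ 2 <= M ^ 2) by nra.
        assert (T4 := pow2_ge_0 (phi t - x)).
        unfold k.
        apply Rle_trans with (2 * phi t ^ 2 * ((phi t - x) ^ 2 * (Rabs ga / 4 + 3 * M * (Rabs a3 / 5)))).
        + apply Rmult_le_compat_l; [lra|]. apply Rmult_le_compat_l; lra.
        + assert (0 <= (phi t - x) ^ 2 * (Rabs ga / 4 + 3 * M * (Rabs a3 / 5)))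
            by (apply Rmult_le_pos; lra).
          nra.
      - lra.
      - destruct (Rle_lt_or_eq_dec tau t1 (proj2 Htau)); [assumption|].
        subst tau. lra. }
    lra.
Qed.

(** * Characterization of nonexistence *)

Lemma Gquot_continuity (a1 a3 om ga : R) : continuity (Gquot a1 a3 om ga).
Proof.
  apply is_derive_continuity with (dh := dGquot a1 a3 om ga).
  intros x. unfold Gquot, dGquot. auto_derive; [trivial|field].
Qed.

(** [x0] is the supremum of the points up to which [h] stays positive. A positive value there would
    let the interval be extended, a negative one would spread to points on its left. *)
Lemma first_zero (h : R -> R) (b : R) :
  continuity h -> 0 < h 0 -> 0 < b -> h b < 0 ->
  exists x0, 0 < x0 < b /\ h x0 = 0 /\ forall x, 0 < x < x0 -> 0 < h x.
Proof.
  intros Hc H0 Hb Hhb.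
  assert (Hnear : forall x, h x <> 0 -> exists d, 0 < d /\
            forall y, Rabs (y - x) < d -> 0 < h y * h x).
  { intros x Hx. assert (C := Hc x). apply continuity_pt_filterlim in C.
    assert (P : 0 < Rabs (h x)) by now apply Rabs_pos_lt.
    apply filterlim_locally with (eps := mkposreal _ P) in C.
    destruct C as [d Hd]. exists d. split; [apply cond_pos|].
    intros y Hy. specialize (Hd y Hy).
    change (Rabs (h y - h x) < Rabs (h x)) in Hd.
    apply Rabs_def2 in Hd. unfold Rabs in Hd. destruct (Rcase_abs (h x)); nra. }
  destruct (completeness (fun x => 0 <= x <= b /\ forall y, 0 <= y <= x -> 0 < h y))
    as [x0 [Hub Hlub]].
  { exists b. intros x Hx. apply Hx. }
  { exists 0. split; [lra|]. intros y Hy. now replace y with 0 by lra. }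
  assert (Hx00 : 0 <= x0).
  { apply Hub. split; [lra|]. intros y Hy. now replace y with 0 by lra. }
  assert (Hx0b : x0 <= b) by (apply Hlub; intros x Hx; apply Hx).
  assert (Hbelow : forall x, 0 <= x < x0 -> 0 < h x).
  { intros x Hx. apply Rnot_le_lt. intros Hneg.
    assert (x0 <= x); [|lra].
    apply Hlub. intros e [He1 He2]. apply Rnot_lt_le. intros Hlt.
    specialize (He2 x ltac:(lra)). lra. }
  assert (Hz : h x0 = 0).
  { destruct (Req_dec (h x0) 0) as [e|Hne]; [exact e|exfalso].
    destruct (Hnear x0 Hne) as [d [Hd Hdn]].
    destruct (Rtotal_order (h x0) 0) as [Hn|[Hn|Hp]]; [|lra|].
    - assert (x0 <> 0) by (intros e; rewrite e in Hn; lra).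
      set (y := Rmax (x0 / 2) (x0 - d / 2)).
      assert (x0 / 2 <= y /\ x0 - d / 2 <= y /\ y < x0).
      { unfold y. split; [apply Rmax_l|split; [apply Rmax_r|apply Rmax_lub_lt; lra]]. }
      specialize (Hdn y ltac:(apply Rabs_def1; lra)).
      specialize (Hbelow y ltac:(lra)). nra.
    - assert (x0 <> b) by (intros e; rewrite e in Hp; lra).
      set (y := Rmin b (x0 + d / 2)).
      assert (y <= b /\ y <= x0 + d / 2 /\ x0 < y).
      { unfold y. split; [apply Rmin_l|split; [apply Rmin_r|apply Rmin_glb_lt; lra]]. }
      assert (y <= x0); [|lra].
      apply Hub. split; [lra|]. intros w Hw.
      destruct (Rlt_or_le w x0); [apply Hbelow; lra|].
      specialize (Hdn w ltac:(apply Rabs_def1; lra)). nra. }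
  exists x0. split; [split|split; [exact Hz|]].
  - destruct Hx00 as [|e]; [assumption|]. rewrite <- e in Hz. lra.
  - destruct Hx0b as [|e]; [assumption|]. rewrite e in Hz. lra.
  - intros x Hx. apply Hbelow. lra.
Qed.

(** [Gquot] starts at [om / 2 > 0], so the negative value at [b] yields a first zero, reached from
    above. Its derivative there is negative, giving a profile, or zero; a positive one would make
    [Gquot] negative just to the left. *)
Lemma profile_or_double_root (a1 a3 om ga b : R) :
  0 < om -> 0 < b -> Gquot a1 a3 om ga b < 0 ->
  (exists phi, standing_wave_profile a1 a3 om ga phi) \/
  exists t, 0 < t /\ Gquot a1 a3 om ga t = 0 /\ dGquot a1 a3 om ga t = 0 /\
    forall x, 0 < x < t -> 0 < Gquot a1 a3 om ga x.
Proof.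
  intros Hom Hb HHb.
  destruct (first_zero (Gquot a1 a3 om ga) b) as [t [Ht [Hz Hpos]]]; auto.
  { apply Gquot_continuity. } { unfold Gquot. lra. }
  destruct (Rtotal_order (dGquot a1 a3 om ga t) 0) as [Hn|[Hn|Hp]].
  - left. apply profile_of_transversal_root with t; auto. lra.
  - right. exists t. repeat split; auto. lra.
  - exfalso. set (d := dGquot a1 a3 om ga t) in *.
    set (K := Rabs ga / 4 + 3 * t * (Rabs a3 / 5) + 1).
    assert (HK : 0 < K).
    { unfold K. assert (A1 := Rabs_pos ga). assert (A2 := Rabs_pos a3). nra. }
    assert (P : 0 < d / (2 * K)) by (apply Rdiv_lt_0_compat; lra).
    (* The first bound keeps [t - e] positive; the second makes the quadratic remainder at most half
       of the linear term [e * d]. *)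
    set (e := Rmin (t / 2) (d / (2 * K))).
    assert (He : 0 < e <= t / 2) by (split; [apply Rmin_glb_lt; lra|apply Rmin_l]).
    assert (He2 : e * K <= d / 2).
    { replace (d / 2) with (d / (2 * K) * K) by (field; lra).
      apply Rmult_le_compat_r; [lra|apply Rmin_r]. }
    specialize (Hpos (t - e) ltac:(lra)).
    set (q := ga / 4 - a3 / 5 * (3 * t - e)).
    replace (Gquot a1 a3 om ga (t - e)) with (- e * (d - e * q)) in Hpos.
    2:{ transitivity (Gquot a1 a3 om ga t - e * d + e ^ 2 * q).
        - rewrite Hz. ring.
        - unfold d, q, Gquot, dGquot. field. }
    assert (q <= K).
    { assert (Bg := Rle_abs ga).
      assert (Ba := proj1 (Rabs_le_between a3 _) (Rle_refl _)).
      unfold q, K. nra. }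
    nra.
Qed.

Definition curve_om (a1 a3 t : R) : R := a1 / 3 * t - a3 / 5 * t ^ 3.
Definition curve_ga (a1 a3 t : R) : R := a1 * (2 / (3 * t)) + 6 / 5 * a3 * t.

Lemma double_root_iff (a1 a3 om ga t : R) : 0 < t ->
  Gquot a1 a3 om ga t = 0 /\ dGquot a1 a3 om ga t = 0 <-> om = curve_om a1 a3 t /\ ga = curve_ga a1 a3 t.
Proof.
  intros Ht. split.
  - intros [Hz Hd].
    assert (E : ga = curve_ga a1 a3 t).
    { transitivity (2 / t * (dGquot a1 a3 om ga t + a1 / 3 + 3 * a3 / 5 * t ^ 2)).
      - unfold dGquot. field. lra.
      - rewrite Hd. unfold curve_ga. field. lra. }
    split; [|exact E].
    transitivity (2 * Gquot a1 a3 om ga t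
                  + (2 * a1 / 3 * t - ga / 2 * t ^ 2 + 2 * a3 / 5 * t ^ 3)).
    + unfold Gquot. field.
    + rewrite Hz, E. unfold curve_ga, curve_om. field. lra.
  - intros [-> ->]. unfold Gquot, dGquot, curve_om, curve_ga. split; field; lra.
Qed.

(** The cofactor of the double zero is affine, fixed by the constant and leading coefficients. When
    [om > 0] it vanishes at [5 * om / (2 * t ^ 2)] if [a3 = 1], and has no positive zero if
    [a3 = -1]. *)
Lemma Gquot_on_curve (a1 a3 t x : R) : 0 < t ->
  Gquot a1 a3 (curve_om a1 a3 t) (curve_ga a1 a3 t) x
  = (x - t) ^ 2 * (curve_om a1 a3 t / (2 * t ^ 2) - a3 / 5 * x).
Proof. intros Ht. unfold Gquot, curve_om, curve_ga. field. lra. Qed.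

Lemma Gquot_shift (a1 a3 om ga ga' x : R) :
  Gquot a1 a3 om ga x = Gquot a1 a3 om ga' x + (ga - ga') / 4 * x ^ 2.
Proof. unfold Gquot. field. Qed.

Lemma Gquot_focusing_negative (a1 om ga : R) :
  a1 = 1 \/ a1 = -1 -> 0 < om -> exists b, 0 < b /\ Gquot a1 1 om ga b < 0.
Proof.
  (* As [b > 1], the lower terms are at most [(b - 1) / 5 * b ^ 2], which is less than the cubic
     term [b ^ 3 / 5]. *)
  intros Ha1 Hom. set (b := 5 * (om / 2 + 1 / 3 + Rabs ga / 4) + 1).
  assert (Pg := Rabs_pos ga). assert (Bg := Rle_abs ga).
  assert (Hb : 1 < b) by (unfold b; lra).
  exists b. split; [lra|].
  assert (E : om / 2 + 1 / 3 + Rabs ga / 4 = (b - 1) / 5) by (unfold b; field).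
  assert (b <= b ^ 2) by nra. assert (1 <= b ^ 2) by nra.
  assert (S1 : om / 2 <= om / 2 * b ^ 2) by nra.
  assert (S2 : - a1 / 3 * b <= 1 / 3 * b ^ 2) by (destruct Ha1; subst a1; nra).
  assert (S3 : ga / 4 * b ^ 2 <= Rabs ga / 4 * b ^ 2) by (apply Rmult_le_compat_r; lra).
  assert (S4 : (b - 1) / 5 * b ^ 2 = 1 / 5 * b ^ 3 - b ^ 2 / 5) by field.
  rewrite <- E in S4. unfold Gquot. lra.
Qed.

Lemma R_no_iff (a1 a3 : R) (p : R * R) :
  R_no a1 a3 p <->
  0 < fst p /\ ~ exists phi, standing_wave_profile a1 a3 (fst p) (snd p) phi.
Proof. unfold R_no, R_ex, half_plane. tauto. Qed.

(** The last inequality says that the double zero [t] does not exceed the third zero, equality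
    meaning a triple zero. If it fails, the third zero comes first, so [t] is not the obstruction.
    If it holds, every positive zero, in particular the maximum of a profile, is at least [t], and
    the profile would have to cross [t]. *)
Lemma R_no_focusing (a1 : R) (p : R * R) : a1 = 1 \/ a1 = -1 ->
  R_no a1 1 p <->
  exists t, 0 < t /\ p = (curve_om a1 1 t, curve_ga a1 1 t) /\
    0 < curve_om a1 1 t /\ t ^ 3 <= 5 / 2 * curve_om a1 1 t.
Proof.
  intros Ha1. rewrite R_no_iff. destruct p as [om ga]. simpl fst. simpl snd. split.
  - intros [Hom Hno]. destruct (Gquot_focusing_negative a1 om ga Ha1 Hom) as [b [Hb HHb]].
    destruct (profile_or_double_root a1 1 om ga b Hom Hb HHb) as [Hex|[t [Ht [Hz [Hd Hpos]]]]];
      [tauto|].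
    destruct (proj1 (double_root_iff a1 1 om ga t Ht) (conj Hz Hd)) as [-> ->].
    exists t. repeat split; auto.
    apply Rnot_lt_le. intros Hlt.
    set (s := 5 * (curve_om a1 1 t / (2 * t ^ 2))).
    assert (Hs : 0 < s < t).
    { unfold s. assert (0 < t ^ 2) by nra. split.
      - apply Rmult_lt_0_compat; [lra|]. apply Rdiv_lt_0_compat; lra.
      - apply Rmult_lt_reg_r with (t ^ 2); [lra|].
        replace (5 * (curve_om a1 1 t / (2 * t ^ 2)) * t ^ 2) with (5 / 2 * curve_om a1 1 t) by (field; lra).
        lra. }
    specialize (Hpos s Hs). rewrite Gquot_on_curve in Hpos by assumption.
    replace (curve_om a1 1 t / (2 * t ^ 2) - 1 / 5 * s) with 0 in Hpos by (unfold s; field; lra).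
    lra.
  - intros [t [Ht [Ep [Hom Hle]]]]. injection Ep as -> ->. split; [assumption|].
    intros [phi Hphi]. destruct (profile_root _ _ _ _ _ Hphi) as [M [HM [Hz Hnd]]].
    destruct (proj2 (double_root_iff a1 1 _ _ t Ht) (conj eq_refl eq_refl)) as [Hz' Hd'].
    apply (Hnd t); auto. split; [assumption|].
    rewrite Gquot_on_curve in Hz by assumption.
    apply Rmult_integral in Hz. destruct Hz as [Hz|Hz]; [nra|].
    assert (0 < t ^ 2) by nra.
    apply Rmult_le_reg_r with (t ^ 2); [lra|].
    replace M with (5 * (curve_om a1 1 t / (2 * t ^ 2))) by lra.
    replace (5 * (curve_om a1 1 t / (2 * t ^ 2)) * t ^ 2) with (5 / 2 * curve_om a1 1 t) by (field; lra).
    lra.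
Qed.

(** For fixed omega, [Gquot] increases with gamma at each positive point. On the curve it is
    nonnegative with [t] as its only positive zero. Below the curve it is negative at [t], and
    uniqueness of the parameter excludes a double zero, so a profile exists; above, no positive zero
    is left for the maximum of a profile. *)
Lemma R_no_defocusing (a1 : R) (p : R * R) :
  (forall om, 0 < om -> exists t, 0 < t /\ curve_om a1 (-1) t = om) ->
  (forall s t, 0 < s -> 0 < t -> 0 < curve_om a1 (-1) s ->
     curve_om a1 (-1) s = curve_om a1 (-1) t -> s = t) ->
  R_no a1 (-1) p <->
  exists t, 0 < t /\ 0 < fst p /\ curve_om a1 (-1) t = fst p /\ curve_ga a1 (-1) t <= snd p.
Proof.
  intros Hsurj Hinj. rewrite R_no_iff. destruct p as [om ga]. simpl fst. simpl snd. split.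
  - intros [Hom Hno]. destruct (Hsurj om Hom) as [t [Ht Et]].
    exists t. repeat split; auto. apply Rnot_lt_le. intros Hlt.
    assert (HHt : Gquot a1 (-1) om ga t < 0).
    { rewrite (Gquot_shift _ _ _ _ (curve_ga a1 (-1) t)), <- Et, Gquot_on_curve by assumption.
      assert (0 < t ^ 2) by nra. nra. }
    destruct (profile_or_double_root a1 (-1) om ga t Hom Ht HHt) as [Hex|[s [Hs [Hz [Hd _]]]]];
      [tauto|].
    destruct (proj1 (double_root_iff a1 (-1) om ga s Hs) (conj Hz Hd)) as [E1 E2].
    assert (s = t) by (apply Hinj; auto; lra). subst s. lra.
  - intros [t [Ht [Hom [Et Hle]]]]. split; [assumption|].
    intros [phi Hphi]. destruct (profile_root _ _ _ _ _ Hphi) as [M [HM [Hz Hnd]]].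
    assert (Hz' := Hz).
    rewrite (Gquot_shift _ _ _ _ (curve_ga a1 (-1) t)), <- Et, Gquot_on_curve in Hz' by assumption.
    assert (P0 : 0 < curve_om a1 (-1) t / (2 * t ^ 2)).
    { apply Rdiv_lt_0_compat; [lra|nra]. }
    assert (P1 := pow2_ge_0 (M - t)). assert (P2 : 0 < M ^ 2) by nra.
    set (c := curve_om a1 (-1) t / (2 * t ^ 2) - -1 / 5 * M) in Hz'.
    assert (P3 : 0 < c) by (unfold c; lra).
    assert (P4 : 0 <= (M - t) ^ 2 * c) by (apply Rmult_le_pos; lra).
    assert (Eg : ga = curve_ga a1 (-1) t) by nra.
    assert (EM : M = t).
    { rewrite Eg in Hz'. assert (Z : (M - t) ^ 2 * c = 0) by lra.
      apply Rmult_integral in Z. destruct Z as [Z|Z]; [|lra]. nra. }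
    rewrite EM in Hz, Hnd. apply (Hnd t); [lra|assumption|].
    apply double_root_iff; auto.
Qed.

(** * Geometry of the curve *)

(** Covers both (l, u] and (l, infinity). The derivative of [curve_om] is required to be positive
    only strictly below a point of [D], so it may vanish at a right end, as it does at the cusp. *)
Definition admissible (a1 a3 l : R) (D : R -> Prop) : Prop :=
  0 <= l /\ 0 <= curve_om a1 a3 l /\
  (forall t, D t -> l < t) /\
  (forall s t, l < s <= t -> D t -> D s) /\
  (forall c t, l < c < t -> D t -> 0 < a1 / 3 - 3 * a3 / 5 * c ^ 2).

Lemma is_derive_curve_om (a1 a3 t : R) :
  is_derive (curve_om a1 a3) t (a1 / 3 - 3 * a3 / 5 * t ^ 2).
Proof. unfold curve_om. auto_derive; [trivial|field]. Qed.

(* Along the curve, dgamma = - 2 / t ^ 2 domega; this also covers the cusp at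
   [a1 / 3 = 3 * a3 / 5 * t ^ 2], where both differentials vanish. *)
Lemma is_derive_curve_ga (a1 a3 t : R) : 0 < t ->
  is_derive (curve_ga a1 a3) t (- 2 / t ^ 2 * (a1 / 3 - 3 * a3 / 5 * t ^ 2)).
Proof. intros Ht. unfold curve_ga. auto_derive; [lra|field; lra]. Qed.

Lemma curve_om_increasing (a1 a3 l : R) (D : R -> Prop) (s t : R) :
  admissible a1 a3 l D -> l <= s < t -> D t -> curve_om a1 a3 s < curve_om a1 a3 t.
Proof.
  intros [Hl [_ [_ [_ Hd]]]] Hst Dt.
  destruct (is_derive_mvt (curve_om a1 a3) (fun t => a1 / 3 - 3 * a3 / 5 * t ^ 2) s t)
    as [c [Hc Ec]]; [lra|intros; apply is_derive_curve_om|].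
  assert (P := Hd c t ltac:(lra) Dt). nra.
Qed.

Lemma curve_om_lt_inv (a1 a3 l : R) (D : R -> Prop) (s t : R) :
  admissible a1 a3 l D -> l <= t -> D s ->
  curve_om a1 a3 s < curve_om a1 a3 t -> s < t.
Proof.
  intros A Ht Ds Hlt. apply Rnot_le_lt. intros [Hc|Hc].
  - assert (P := curve_om_increasing _ _ _ _ t s A (conj Ht Hc) Ds). lra.
  - subst t. lra.
Qed.

Lemma curve_om_pos (a1 a3 l : R) (D : R -> Prop) (t : R) :
  admissible a1 a3 l D -> D t -> 0 < curve_om a1 a3 t.
Proof.
  intros A Dt. assert (A' := A). destruct A' as [_ [Hp [Hl _]]].
  assert (P := curve_om_increasing _ _ _ _ l t A (conj (Rle_refl l) (Hl t Dt)) Dt). lra.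
Qed.

Lemma curve_om_inj (a1 a3 l : R) (D : R -> Prop) (s t : R) :
  admissible a1 a3 l D -> D s -> D t -> curve_om a1 a3 s = curve_om a1 a3 t -> s = t.
Proof.
  intros A Ds Dt E. assert (A' := A). destruct A' as [_ [_ [Hl _]]].
  assert (Ls := Hl s Ds). assert (Lt := Hl t Dt).
  destruct (Rtotal_order s t) as [h|[h|h]]; [|exact h|].
  - assert (P := curve_om_increasing _ _ _ _ s t A ltac:(lra) Dt). lra.
  - assert (P := curve_om_increasing _ _ _ _ t s A ltac:(lra) Ds). lra.
Qed.

Lemma curve_ga_decreasing (a1 a3 l : R) (D : R -> Prop) (s t : R) :
  admissible a1 a3 l D -> l < s < t -> D t -> curve_ga a1 a3 t < curve_ga a1 a3 s.
Proof.
  intros [Hl [_ [_ [_ Hd]]]] Hst Dt.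
  destruct (is_derive_mvt (curve_ga a1 a3)
    (fun t => - 2 / t ^ 2 * (a1 / 3 - 3 * a3 / 5 * t ^ 2)) s t)
    as [c [Hc Ec]]; [lra|intros; apply is_derive_curve_ga; lra|].
  assert (P := Hd c t ltac:(lra) Dt).
  assert (N : 0 < 2 / c ^ 2) by (apply Rdiv_lt_0_compat; nra).
  assert (0 < 2 / c ^ 2 * (a1 / 3 - 3 * a3 / 5 * c ^ 2) * (t - s))
    by (apply Rmult_lt_0_compat; [apply Rmult_lt_0_compat|]; lra).
  replace (- 2 / c ^ 2 * (a1 / 3 - 3 * a3 / 5 * c ^ 2) * (t - s)) with
    (- (2 / c ^ 2 * (a1 / 3 - 3 * a3 / 5 * c ^ 2) * (t - s))) in Ec by (field; lra).
  lra.
Qed.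

(* Cauchy's mean value theorem for the two coordinates of the curve. *)
Lemma chord_slope_ordered (a1 a3 l : R) (D : R -> Prop) (s t : R) :
  admissible a1 a3 l D -> l < s < t -> D t ->
  exists c, s < c < t /\
    (curve_ga a1 a3 t - curve_ga a1 a3 s) / (curve_om a1 a3 t - curve_om a1 a3 s) = - 2 / c ^ 2.
Proof.
  intros A Hst Dt.
  assert (Hom := curve_om_increasing _ _ _ _ s t A ltac:(lra) Dt).
  destruct A as [Hl [_ [_ [_ Hd]]]].
  set (dg := curve_ga a1 a3 t - curve_ga a1 a3 s). set (dom := curve_om a1 a3 t - curve_om a1 a3 s).
  (* The combination has equal values at [s] and [t], and its derivative contains the factor
     [curve_om'], positive strictly between them. Cancelling it gives the slope even if [t] is the
     cusp. *)
  destruct (is_derive_mvt (fun c => dg * curve_om a1 a3 c - dom * curve_ga a1 a3 c)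
    (fun c => (dg + dom * (2 / c ^ 2)) * (a1 / 3 - 3 * a3 / 5 * c ^ 2)) s t)
    as [c [Hc Ec]]; [lra| |].
  { intros c Hc.
    assert (D1 := is_derive_curve_om a1 a3 c).
    assert (D2 := is_derive_curve_ga a1 a3 c ltac:(lra)).
    auto_derive.
    - split; [now eexists; apply D1|]. split; [now eexists; apply D2|trivial].
    - rewrite (Derive_eta _ _ _ D1), (Derive_eta _ _ _ D2). field. lra. }
  exists c. split; [exact Hc|].
  replace (dg * curve_om a1 a3 t - dom * curve_ga a1 a3 t - (dg * curve_om a1 a3 s - dom * curve_ga a1 a3 s))
    with 0 in Ec by (unfold dg, dom; ring).
  assert (P := Hd c t ltac:(lra) Dt).
  assert (E0 : dg + dom * (2 / c ^ 2) = 0).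
  { symmetry in Ec. apply Rmult_integral in Ec. destruct Ec as [Ec|Ec]; [|lra].
    apply Rmult_integral in Ec. destruct Ec; [assumption|lra]. }
  assert (dom <> 0) by (unfold dom; lra).
  replace dg with (- (dom * (2 / c ^ 2))) by lra. field. lra.
Qed.

Lemma chord_slope (a1 a3 l : R) (D : R -> Prop) (s t : R) :
  admissible a1 a3 l D -> D s -> D t -> s <> t ->
  exists c, Rabs (c - t) < Rabs (s - t) /\
    (curve_ga a1 a3 s - curve_ga a1 a3 t) / (curve_om a1 a3 s - curve_om a1 a3 t) = - 2 / c ^ 2.
Proof.
  intros A Ds Dt Hne. assert (A' := A). destruct A' as [_ [_ [Hl _]]].
  assert (Ls := Hl s Ds). assert (Lt := Hl t Dt).
  destruct (Rdichotomy s t Hne) as [h|h].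
  - destruct (chord_slope_ordered _ _ _ _ s t A ltac:(lra) Dt) as [c [Hc Ec]].
    assert (Hom := curve_om_increasing _ _ _ _ s t A ltac:(lra) Dt).
    exists c. split.
    + rewrite (Rabs_left1 (s - t)) by lra. apply Rabs_def1; lra.
    + rewrite <- Ec. field. lra.
  - destruct (chord_slope_ordered _ _ _ _ t s A ltac:(lra) Ds) as [c [Hc Ec]].
    exists c. split; [|exact Ec].
    rewrite (Rabs_pos_eq (s - t)) by lra. apply Rabs_def1; lra.
Qed.

Lemma near_fst (p : R * R) (P : R -> Prop) :
  locally (fst p) P -> locally p (fun q => P (fst q)).
Proof. destruct p as [x y]. intros [d Hd]. exists d. intros q Hq. apply Hd, Hq. Qed.

Lemma near_snd (p : R * R) (P : R -> Prop) :
  locally (snd p) P -> locally p (fun q => P (snd q)).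
Proof. destruct p as [x y]. intros [d Hd]. exists d. intros q Hq. apply Hd, Hq. Qed.

Lemma near_gt (x a : R) : a < x -> locally x (fun y => a < y).
Proof. intros Hx. now apply (open_gt a). Qed.

Lemma near_lt (x a : R) : x < a -> locally x (fun y => y < a).
Proof. intros Hx. now apply (open_lt a). Qed.

Lemma locally_left (x l : R) (P : R -> Prop) :
  l < x -> locally x P -> exists y, l < y < x /\ P y.
Proof.
  intros Hx [d Hd]. assert (Pd := cond_pos d).
  exists (Rmax ((l + x) / 2) (x - d / 2)).
  assert (B1 := Rmax_l ((l + x) / 2) (x - d / 2)).
  assert (B2 := Rmax_r ((l + x) / 2) (x - d / 2)).
  assert (B3 : Rmax ((l + x) / 2) (x - d / 2) < x) by (apply Rmax_lub_lt; lra).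
  split; [lra|]. apply Hd. change (Rabs (Rmax ((l + x) / 2) (x - d / 2) - x) < d).
  apply Rabs_def1; lra.
Qed.

Lemma locally_right (x u : R) (P : R -> Prop) :
  x < u -> locally x P -> exists y, x < y < u /\ P y.
Proof.
  intros Hx [d Hd]. assert (Pd := cond_pos d).
  exists (Rmin ((u + x) / 2) (x + d / 2)).
  assert (B1 := Rmin_l ((u + x) / 2) (x + d / 2)).
  assert (B2 := Rmin_r ((u + x) / 2) (x + d / 2)).
  assert (B3 : x < Rmin ((u + x) / 2) (x + d / 2)) by (apply Rmin_glb_lt; lra).
  split; [lra|]. apply Hd. change (Rabs (Rmin ((u + x) / 2) (x + d / 2) - x) < d).
  apply Rabs_def1; lra.
Qed.

Lemma curve_om_continuous (a1 a3 t : R) : continuous (curve_om a1 a3) t.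
Proof. apply (ex_derive_continuous (curve_om a1 a3)). eexists. apply is_derive_curve_om. Qed.

Lemma curve_ga_continuous (a1 a3 t : R) : 0 < t -> continuous (curve_ga a1 a3) t.
Proof.
  intros Ht. apply (ex_derive_continuous (curve_ga a1 a3)). eexists. now apply is_derive_curve_ga.
Qed.

(* The inverse of [curve_om] on [D] is continuous, hence a point of the curve close
   to [p] has a parameter close to that of [p]. *)
Lemma parameter_near (a1 a3 l : R) (D : R -> Prop) (t d : R) :
  admissible a1 a3 l D -> D t -> 0 < d ->
  locally (curve_om a1 a3 t) (fun w => forall s, D s -> w = curve_om a1 a3 s -> Rabs (s - t) < d).
Proof.
  intros A Dt Hd. assert (A' := A). destruct A' as [_ [_ [Hl [Hdown _]]]].
  assert (Lt := Hl t Dt).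
  set (s1 := Rmax l (t - d)).
  assert (B1 : l <= s1) by apply Rmax_l.
  assert (B2 : t - d <= s1) by apply Rmax_r.
  assert (B3 : s1 < t) by (apply Rmax_lub_lt; lra).
  assert (N1 := near_gt _ _ (curve_om_increasing _ _ _ _ s1 t A (conj B1 B3) Dt)).
  (* If [t + d] lies outside [D], downward closure already keeps every parameter below [t + d]; this
     covers a right end of the curve. *)
  destruct (classic (D (t + d))) as [Du|Du].
  - assert (N2 := near_lt _ _ (curve_om_increasing _ _ _ _ t (t + d) A ltac:(lra) Du)).
    generalize (filter_and _ _ N1 N2). apply filter_imp.
    intros w [W1 W2] s Ds Es. subst w.
    assert (s < t + d) by (apply (curve_om_lt_inv _ _ _ _ _ _ A) in W2; auto; lra).
    assert (s1 < s).
    { apply Rnot_le_lt. intros [Hc|Hc]; [|subst s; lra].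
      assert (P := curve_om_increasing _ _ _ _ s s1 A (conj (Rlt_le _ _ (Hl s Ds)) Hc)
                     (Hdown s1 t ltac:(specialize (Hl s Ds); lra) Dt)). lra. }
    apply Rabs_def1; lra.
  - revert N1. apply filter_imp. intros w W1 s Ds Es. subst w.
    assert (s < t + d).
    { apply Rnot_le_lt. intros Hc. apply Du, (Hdown _ s); [lra|assumption]. }
    assert (s1 < s).
    { apply Rnot_le_lt. intros [Hc|Hc]; [|subst s; lra].
      assert (P := curve_om_increasing _ _ _ _ s s1 A (conj (Rlt_le _ _ (Hl s Ds)) Hc)
                     (Hdown s1 t ltac:(specialize (Hl s Ds); lra) Dt)). lra. }
    apply Rabs_def1; lra.
Qed.

(** Chords have slope [- 2 / c ^ 2] with [c] closer to [t] than the other parameter, and points near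
    [p] on the curve have parameters near [t]; so the limit is [- 2 / t ^ 2], without dividing by
    the derivative of [curve_om]. *)
Lemma curve_negative_slope (a1 a3 l : R) (D : R -> Prop) :
  admissible a1 a3 l D -> negative_slope (param_curve (curve_om a1 a3) (curve_ga a1 a3) D).
Proof.
  intros A p [t [Dt ->]]. assert (A' := A). destruct A' as [L0 [_ [Hl [Hdown _]]]].
  assert (Lt := Hl t Dt).
  exists (- 2 / t ^ 2). split.
  { assert (0 < 2 / t ^ 2) by (apply Rdiv_lt_0_compat; nra).
    replace (- 2 / t ^ 2) with (- (2 / t ^ 2)) by (field; lra). lra. }
  assert (Hne : forall s, D s -> (curve_om a1 a3 s, curve_ga a1 a3 s) <> (curve_om a1 a3 t, curve_ga a1 a3 t) -> s <> t).
  { intros s _ Hq e. apply Hq. now rewrite e. }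
  split; [|split; [|split]].
  - now exists t.
  - intros U HU.
    assert (C : continuous (fun s => (curve_om a1 a3 s, curve_ga a1 a3 s)) t).
    { assert (T0 : 0 < t) by lra. intros V [d HV].
      generalize (filter_and _ _
        (proj1 (filterlim_locally _ _) (curve_om_continuous a1 a3 t) d)
        (proj1 (filterlim_locally _ _) (curve_ga_continuous a1 a3 t T0) d)).
      unfold filtermap.
      apply filter_imp. intros s [S1 S2]. now apply HV. }
    (* Smaller parameters are used because [D] always contains those between [l] and [t], while [t]
       may be its right end. *)
    destruct (locally_left t l _ Lt (C U HU)) as [s [Hs Us]].
    assert (Ds : D s) by (apply (Hdown s t); [lra|assumption]).
    exists (curve_om a1 a3 s, curve_ga a1 a3 s). split; [exact Us|]. split; [now exists s|].
    intros e. injection e as e _. apply (curve_om_inj _ _ _ _ s t A) in e; auto. lra.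
  - unfold within. apply filter_forall. intros q [[s [Ds ->]] Hq] e. simpl in e.
    apply (Hne s Ds Hq). now apply (curve_om_inj _ _ _ _ s t A).
  - apply filterlim_locally. intros eps.
    assert (C : continuous (fun c => - 2 / c ^ 2) t).
    { apply (ex_derive_continuous (fun c => - 2 / c ^ 2)). auto_derive.
      repeat split; auto. nra. }
    destruct (proj1 (filterlim_locally _ _) C eps) as [d Hd].
    generalize (near_fst (curve_om a1 a3 t, curve_ga a1 a3 t) _
      (parameter_near _ _ _ _ t d A Dt (cond_pos d))).
    unfold within. apply filter_imp. intros q Hq [[s [Ds ->]] Hqp]. simpl in Hq |- *.
    specialize (Hq s Ds eq_refl).
    destruct (chord_slope _ _ _ _ s t A Ds Dt (Hne s Ds Hqp)) as [c [Hc ->]].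
    apply Hd. change (Rabs (c - t) < d). lra.
Qed.

Lemma near_curve_left (a1 a3 l t y : R) :
  0 <= l < t -> curve_ga a1 a3 t < y -> exists s, l < s < t /\ curve_ga a1 a3 s < y.
Proof.
  intros Ht Hy. apply (locally_left t l); [lra|].
  assert (C := curve_ga_continuous a1 a3 t ltac:(lra)). exact (C (fun w => w < y) (near_lt _ _ Hy)).
Qed.

Lemma near_curve_right (a1 a3 t u y : R) :
  0 < t < u -> y < curve_ga a1 a3 t -> exists s, t < s < u /\ y < curve_ga a1 a3 s.
Proof.
  intros Ht Hy. apply (locally_right t u); [lra|].
  assert (C := curve_ga_continuous a1 a3 t ltac:(lra)). exact (C (fun w => y < w) (near_gt _ _ Hy)).
Qed.

Lemma vertical_approach (p : R * R) (U : R * R -> Prop) (P : R -> Prop) :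
  locally p U -> (exists l, l < snd p /\ forall y, l < y < snd p -> P y)
              \/ (exists u, snd p < u /\ forall y, snd p < y < u -> P y) ->
  exists y, U (fst p, y) /\ P y.
Proof.
  destruct p as [x y0]. simpl. intros [d Hd] HP.
  assert (HU : locally y0 (fun y => U (x, y))).
  { exists d. intros y Hy. apply Hd. split; [apply ball_center|exact Hy]. }
  destruct HP as [[l [Hl HP]]|[u [Hu HP]]].
  - destruct (locally_left y0 l _ Hl HU) as [y [Hy Uy]]. exists y. auto.
  - destruct (locally_right y0 u _ Hu HU) as [y [Hy Uy]]. exists y. auto.
Qed.

(** An arc is its own boundary if it is relatively closed with empty interior. As omega increases
    and gamma decreases along it, a point off the arc is separated from it by a quadrant with corner
    at a nearby arc point. The open end at [l] does no harm since omega vanishes there, outside the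
    half plane. Points vertically above the arc are not on it. *)
Lemma boundary_of_arc (a1 a3 l u : R) (A : R * R -> Prop) (p : R * R) :
  admissible a1 a3 l (fun t => l < t <= u) -> l < u -> curve_om a1 a3 l = 0 ->
  (forall q, A q <-> param_curve (curve_om a1 a3) (curve_ga a1 a3) (fun t => l < t <= u) q) ->
  boundary_in half_plane A p <->
  param_curve (curve_om a1 a3) (curve_ga a1 a3) (fun t => l < t <= u) p.
Proof.
  intros Ad Hlu Hom0 HA. assert (Hl : 0 <= l) by apply Ad. split.
  - intros [Hp Hb]. unfold half_plane in Hp. apply NNPP. intros Hno.
    assert (Hmiss : forall U : R * R -> Prop, locally p U -> exists t, l < t <= u /\
                      U (curve_om a1 a3 t, curve_ga a1 a3 t)).
    { intros U HU. destruct (Hb U HU) as [[q [Uq [_ Aq]]] _].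
      apply HA in Aq. destruct Aq as [t [Ht ->]]. now exists t. }
    destruct (Rlt_or_le (curve_om a1 a3 u) (fst p)) as [Hbig|Hsmall].
    { destruct (Hmiss _ (near_fst p _ (near_gt _ _ Hbig))) as [t [Ht Ut]]. simpl in Ut.
      assert (u < t); [|lra].
      apply Rnot_le_lt. intros [Hc|Hc]; [|subst t; lra].
      assert (P := curve_om_increasing _ _ _ _ t u Ad ltac:(lra) ltac:(lra)). lra. }
    destruct (IVT_gen (curve_om a1 a3) l u (fst p)) as [t0 [Ht0 Et0]].
    { apply is_derive_continuity with (1 := is_derive_curve_om a1 a3). }
    { rewrite Rmin_left, Rmax_right; lra. }
    rewrite Rmin_left, Rmax_right in Ht0 by lra.
    assert (Dt0 : l < t0 <= u).
    { destruct Ht0 as [[h|h] h']; [lra|]. subst t0. lra. }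
    destruct (Rtotal_order (snd p) (curve_ga a1 a3 t0)) as [Hlt|[Heq|Hgt]].
    + destruct (Rlt_or_le t0 u) as [Htu|Htu].
      * destruct (near_curve_right a1 a3 t0 u (snd p) ltac:(lra) Hlt) as [t1 [Ht1 Hg1]].
        assert (Ho1 := curve_om_increasing _ _ _ _ t0 t1 Ad ltac:(lra) ltac:(lra)).
        rewrite Et0 in Ho1.
        destruct (Hmiss _ (filter_and _ _ (near_fst p _ (near_lt _ _ Ho1))
           (near_snd p _ (near_lt _ _ Hg1)))) as [t [Ht [U1 U2]]]. simpl in U1, U2.
        apply (curve_om_lt_inv _ _ _ _ _ _ Ad) in U1; [|lra|lra].
        assert (P := curve_ga_decreasing _ _ _ _ t t1 Ad ltac:(lra) ltac:(lra)). lra.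
      (* There is no arc point further right to serve as a corner, but gamma is least at [u], so a
         horizontal half plane separates. *)
      * assert (t0 = u) by lra. subst t0.
        destruct (Hmiss _ (near_snd p _ (near_lt _ _ Hlt))) as [t [Ht U1]]. simpl in U1.
        destruct (Rlt_or_le t u) as [h|h].
        -- assert (P := curve_ga_decreasing _ _ _ _ t u Ad ltac:(lra) ltac:(lra)). lra.
        -- assert (t = u) by lra. subst t. lra.
    + apply Hno. exists t0. split; [exact Dt0|]. destruct p as [x y]. simpl in *. congruence.
    + destruct (near_curve_left a1 a3 l t0 (snd p) ltac:(lra) Hgt) as [t1 [Ht1 Hg1]].
      assert (Ho1 := curve_om_increasing _ _ _ _ t1 t0 Ad ltac:(lra) ltac:(lra)).
      rewrite Et0 in Ho1.
      destruct (Hmiss _ (filter_and _ _ (near_fst p _ (near_gt _ _ Ho1))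
         (near_snd p _ (near_gt _ _ Hg1)))) as [t [Ht [U1 U2]]]. simpl in U1, U2.
      apply (curve_om_lt_inv _ _ _ _ _ _ Ad) in U1; [|lra|lra].
      assert (P := curve_ga_decreasing _ _ _ _ t1 t Ad ltac:(lra) ltac:(lra)). lra.
  - intros [t [Ht ->]].
    assert (Hpos := curve_om_pos _ _ _ _ t Ad Ht).
    split; [exact Hpos|]. intros U HU. split.
    + exists (curve_om a1 a3 t, curve_ga a1 a3 t).
      split; [now apply locally_singleton|]. split; [exact Hpos|].
      apply HA. now exists t.
    + destruct (vertical_approach _ U (fun y => curve_ga a1 a3 t < y) HU) as [y [Uy Hy]].
      { right. exists (curve_ga a1 a3 t + 1). simpl. split; [lra|]. intros y Hy. lra. }
      exists (curve_om a1 a3 t, y). split; [exact Uy|]. split; [exact Hpos|].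
      intros HAy. apply HA in HAy. destruct HAy as [s [Hs E]]. injection E as E1 E2.
      apply (curve_om_inj _ _ _ _ t s Ad) in E1; auto. subst s. lra.
Qed.

(** The same quadrants, now with corners on both sides available: near a point below the curve they
    miss [A], near a point above it their part in the half plane lies inside [A]. *)
Lemma boundary_of_epigraph (a1 a3 l : R) (A : R * R -> Prop) (p : R * R) :
  admissible a1 a3 l (fun t => l < t) ->
  (forall om, 0 < om -> exists t, l < t /\ curve_om a1 a3 t = om) ->
  (forall q, A q <-> exists t, l < t /\ curve_om a1 a3 t = fst q /\ curve_ga a1 a3 t <= snd q) ->
  boundary_in half_plane A p <->
  param_curve (curve_om a1 a3) (curve_ga a1 a3) (fun t => l < t) p.
Proof.
  intros Ad Hsurj HA. assert (Hl : 0 <= l) by apply Ad. split.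
  - intros [Hp Hb]. unfold half_plane in Hp.
    destruct (Hsurj _ Hp) as [t0 [Ht0 Et0]].
    destruct (Rtotal_order (snd p) (curve_ga a1 a3 t0)) as [Hlt|[Heq|Hgt]].
    + exfalso.
      destruct (near_curve_right a1 a3 t0 (t0 + 1) (snd p) ltac:(lra) Hlt) as [t1 [Ht1 Hg1]].
      assert (Ho1 := curve_om_increasing _ _ _ _ t0 t1 Ad ltac:(lra) ltac:(lra)).
      rewrite Et0 in Ho1.
      destruct (Hb _ (filter_and _ _ (near_fst p _ (near_lt _ _ Ho1))
         (near_snd p _ (near_lt _ _ Hg1)))) as [[q [[U1 U2] [_ Aq]]] _]. simpl in U1, U2.
      apply HA in Aq. destruct Aq as [t [Ht [E1 E2]]]. rewrite <- E1 in U1.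
      apply (curve_om_lt_inv _ _ _ _ _ _ Ad) in U1; [|lra|lra].
      assert (P := curve_ga_decreasing _ _ _ _ t t1 Ad ltac:(lra) ltac:(lra)). lra.
    + exists t0. split; [exact Ht0|]. destruct p as [x y]. simpl in *. congruence.
    + exfalso.
      destruct (near_curve_left a1 a3 l t0 (snd p) ltac:(lra) Hgt) as [t1 [Ht1 Hg1]].
      assert (Ho1 := curve_om_increasing _ _ _ _ t1 t0 Ad ltac:(lra) ltac:(lra)).
      rewrite Et0 in Ho1.
      destruct (Hb _ (filter_and _ _ (near_fst p _ (near_gt _ _ Ho1))
         (near_snd p _ (near_gt _ _ Hg1)))) as [_ [q [[U1 U2] [Hq nAq]]]]. simpl in U1, U2.
      apply nAq, HA. destruct (Hsurj _ Hq) as [t [Ht Et]].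
      exists t. split; [exact Ht|]. split; [exact Et|]. rewrite <- Et in U1.
      apply (curve_om_lt_inv _ _ _ _ _ _ Ad) in U1; [|lra|lra].
      assert (P := curve_ga_decreasing _ _ _ _ t1 t Ad ltac:(lra) ltac:(lra)). lra.
  - intros [t [Ht ->]].
    assert (Hpos := curve_om_pos _ _ _ _ t Ad Ht).
    split; [exact Hpos|]. intros U HU. split.
    + exists (curve_om a1 a3 t, curve_ga a1 a3 t).
      split; [now apply locally_singleton|]. split; [exact Hpos|].
      apply HA. exists t. simpl. repeat split; auto. lra.
    + destruct (vertical_approach _ U (fun y => y < curve_ga a1 a3 t) HU) as [y [Uy Hy]].
      { left. exists (curve_ga a1 a3 t - 1). simpl. split; [lra|]. intros y Hy. lra. }
      exists (curve_om a1 a3 t, y). split; [exact Uy|]. split; [exact Hpos|].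
      intros HAy. apply HA in HAy. destruct HAy as [s [Hs [E1 E2]]]. simpl in E1, E2.
      apply (curve_om_inj _ _ _ _ s t Ad) in E1; auto. subst s. lra.
Qed.

(** * The limits and the four cases *)

Lemma filterlim_at_right_continuous (h : R -> R) (x y : R) :
  continuous h x -> h x = y -> filterlim h (at_right x) (locally y).
Proof.
  intros C <-. eapply filterlim_filter_le_1; [|exact C].
  apply filter_le_within.
Qed.

Lemma curve_ga_lim_at_right_0 (a3 : R) : a3 = 1 \/ a3 = -1 ->
  filterlim (curve_ga 1 a3) (at_right 0) (Rbar_locally p_infty).
Proof.
  intros Ha3 P [M HM].
  assert (AM := Rabs_pos M). assert (LM := Rle_abs M).
  (* The bound [t < 1] keeps the linear term [6 / 5 * t] below the margin 2, whatever its sign. *)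
  assert (P0 : 0 < Rmin 1 (2 / (3 * (Rabs M + 2)))).
  { apply Rmin_glb_lt; [lra|]. apply Rdiv_lt_0_compat; lra. }
  exists (mkposreal _ P0). intros t Ht Htpos. apply HM.
  change (Rabs (t - 0) < Rmin 1 (2 / (3 * (Rabs M + 2)))) in Ht.
  rewrite Rminus_0_r, Rabs_pos_eq in Ht by lra.
  assert (T1 := Rlt_le_trans _ _ _ Ht (Rmin_l _ _)).
  assert (T2 := Rlt_le_trans _ _ _ Ht (Rmin_r _ _)).
  assert (T3 : Rabs M + 2 < 2 / (3 * t)).
  { apply Rmult_lt_reg_r with (3 * t); [lra|].
    replace (2 / (3 * t) * (3 * t)) with 2 by (field; lra).
    apply Rmult_lt_compat_r with (r := 3 * (Rabs M + 2)) in T2; [|lra].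
    replace (2 / (3 * (Rabs M + 2)) * (3 * (Rabs M + 2))) with 2 in T2 by (field; lra).
    lra. }
  unfold curve_ga. destruct Ha3; subst a3; lra.
Qed.

Lemma curve_om_ge (a1 t : R) : a1 = 1 \/ a1 = -1 -> 3 <= t -> t <= curve_om a1 (-1) t.
Proof.
  intros Ha1 Ht. unfold curve_om.
  assert (9 <= t ^ 2) by nra.
  assert (9 * t <= t ^ 3) by (replace (t ^ 3) with (t ^ 2 * t) by ring; nra).
  destruct Ha1; subst a1; lra.
Qed.

Lemma curve_om_lim_p_infty (a1 : R) : a1 = 1 \/ a1 = -1 ->
  filterlim (curve_om a1 (-1)) (Rbar_locally p_infty) (Rbar_locally p_infty).
Proof.
  intros Ha1 P [M HM]. exists (Rmax 3 M). intros t Ht. apply HM.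
  assert (T1 := Rle_lt_trans _ _ _ (Rmax_l 3 M) Ht).
  assert (T2 := Rle_lt_trans _ _ _ (Rmax_r 3 M) Ht).
  assert (T3 := curve_om_ge a1 t Ha1 ltac:(lra)). lra.
Qed.

Lemma curve_ga_lim_p_infty (a1 : R) : a1 = 1 \/ a1 = -1 ->
  filterlim (curve_ga a1 (-1)) (Rbar_locally p_infty) (Rbar_locally m_infty).
Proof.
  intros Ha1 P [M HM]. exists (Rmax 1 (1 - M)). intros t Ht. apply HM.
  assert (T1 := Rle_lt_trans _ _ _ (Rmax_l 1 (1 - M)) Ht).
  assert (T2 := Rle_lt_trans _ _ _ (Rmax_r 1 (1 - M)) Ht).
  assert (T3 : 0 < 2 / (3 * t) < 1).
  { split; [apply Rdiv_lt_0_compat; lra|].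
    apply Rmult_lt_reg_r with (3 * t); [lra|].
    replace (2 / (3 * t) * (3 * t)) with 2 by (field; lra). lra. }
  unfold curve_ga. destruct Ha1; subst a1; lra.
Qed.

Lemma negative_slope_ext (C C' : R * R -> Prop) :
  (forall p, C p <-> C' p) -> negative_slope C' -> negative_slope C.
Proof.
  intros E. replace C with C'; [auto|].
  apply functional_extensionality. intros p.
  apply propositional_extensionality. symmetry. apply E.
Qed.

(** Treats both signs of [a1], which differ in the zero [l] of [curve_om] where omega becomes
    positive: 0 or [sqrt (5 / 3)]. Since omega is positive only beyond [l], monotonicity there gives
    uniqueness among all positive parameters. *)
Lemma defocusing_region (a1 l : R) : a1 = 1 \/ a1 = -1 ->
  admissible a1 (-1) l (fun t => l < t) -> curve_om a1 (-1) l = 0 ->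
  (forall t, 0 < t -> 0 < curve_om a1 (-1) t -> l < t) ->
  (forall p, R_no a1 (-1) p <-> on_or_above (Gamma_no a1 (-1)) p) /\
  (forall p, Gamma_no a1 (-1) p <->
     param_curve (curve_om a1 (-1)) (curve_ga a1 (-1)) (fun t => l < t) p) /\
  negative_slope (Gamma_no a1 (-1)).
Proof.
  intros Ha1 Ad H0 Hbig. assert (Hl : 0 <= l) by apply Ad.
  assert (Hsurj : forall om, 0 < om -> exists t, l < t /\ curve_om a1 (-1) t = om).
  { intros om Hom.
    assert (HT := curve_om_ge a1 (om + l + 3) Ha1 ltac:(lra)).
    destruct (IVT_gen (curve_om a1 (-1)) l (om + l + 3) om) as [t [Ht Et]].
    { apply is_derive_continuity with (1 := is_derive_curve_om a1 (-1)). }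
    { rewrite Rmin_left, Rmax_right; lra. }
    rewrite Rmin_left, Rmax_right in Ht by lra.
    exists t. split; [|exact Et]. destruct Ht as [[h|h] _]; [exact h|]. subst t. lra. }
  assert (HA : forall q, R_no a1 (-1) q <->
            exists t, l < t /\ curve_om a1 (-1) t = fst q /\ curve_ga a1 (-1) t <= snd q).
  { intros q. rewrite R_no_defocusing.
    - split.
      + intros [t [Ht [Hq [E1 E2]]]]. exists t. repeat split; auto. apply Hbig; lra.
      + intros [t [Ht [E1 E2]]]. exists t. repeat split; auto; [lra|].
        rewrite <- E1. apply (curve_om_pos _ _ _ _ t Ad Ht).
    - intros om Hom. destruct (Hsurj om Hom) as [t [Ht Et]]. exists t. split; [lra|exact Et].
    - intros s t Hs Ht Ps E. apply (curve_om_inj _ _ _ _ s t Ad); auto; apply Hbig; lra. }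
  assert (HG : forall p, Gamma_no a1 (-1) p <->
     param_curve (curve_om a1 (-1)) (curve_ga a1 (-1)) (fun t => l < t) p).
  { intros p. now apply boundary_of_epigraph. }
  split; [|split; [exact HG|]].
  - intros p. rewrite HA. split.
    + intros [t [Ht [E1 E2]]]. exists (curve_om a1 (-1) t, curve_ga a1 (-1) t).
      split; [|now split]. apply HG. now exists t.
    + intros [q [Hq [E1 E2]]]. apply HG in Hq. destruct Hq as [t [Ht ->]].
      exists t. now repeat split.
  - apply negative_slope_ext with (1 := HG). now apply curve_negative_slope with l.
Qed.

Theorem theorem3p4 (a1 a3 : R)
  (ha1 : a1 = 1 \/ a1 = -1) (ha3 : a3 = 1 \/ a3 = -1) :
  (a1 = 1 -> a3 = 1 ->
    let om := fun t : R => t / 3 - 1 / 5 * t ^ 3 in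
    let ga := fun t : R => 2 / (3 * t) + 6 / 5 * t in
    (forall p, R_no a1 a3 p <-> Gamma_no a1 a3 p) /\
    (forall p, Gamma_no a1 a3 p <->
       param_curve om ga (fun t => 0 < t <= sqrt 5 / 3) p) /\
    filterlim om (at_right 0) (locally 0) /\
    filterlim ga (at_right 0) (Rbar_locally p_infty) /\
    om (sqrt 5 / 3) = 2 * sqrt 5 / 27 /\
    ga (sqrt 5 / 3) = 4 * sqrt 5 / 5 /\
    negative_slope (Gamma_no a1 a3)) /\
  (a1 = 1 -> a3 = -1 ->
    let om := fun t : R => t / 3 + 1 / 5 * t ^ 3 in
    let ga := fun t : R => 2 / (3 * t) - 6 / 5 * t in
    (forall p, R_no a1 a3 p <-> on_or_above (Gamma_no a1 a3) p) /\
    (forall p, Gamma_no a1 a3 p <-> param_curve om ga (fun t => 0 < t) p) /\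
    filterlim om (at_right 0) (locally 0) /\
    filterlim ga (at_right 0) (Rbar_locally p_infty) /\
    filterlim om (Rbar_locally p_infty) (Rbar_locally p_infty) /\
    filterlim ga (Rbar_locally p_infty) (Rbar_locally m_infty) /\
    negative_slope (Gamma_no a1 a3)) /\
  (a1 = -1 -> a3 = 1 ->
    (forall p, ~ R_no a1 a3 p) /\ (forall p, ~ Gamma_no a1 a3 p)) /\
  (a1 = -1 -> a3 = -1 ->
    let om := fun t : R => - t / 3 + 1 / 5 * t ^ 3 in
    let ga := fun t : R => - 2 / (3 * t) - 6 / 5 * t in
    (forall p, R_no a1 a3 p <-> on_or_above (Gamma_no a1 a3) p) /\
    (forall p, Gamma_no a1 a3 p <->
       param_curve om ga (fun t => sqrt (5 / 3) < t) p) /\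
    filterlim om (at_right (sqrt (5 / 3))) (locally 0) /\
    filterlim ga (at_right (sqrt (5 / 3))) (locally (- (8 * sqrt 15 / 15))) /\
    filterlim om (Rbar_locally p_infty) (Rbar_locally p_infty) /\
    filterlim ga (Rbar_locally p_infty) (Rbar_locally m_infty) /\
    negative_slope (Gamma_no a1 a3)).
Proof.
  split; [|split; [|split]]; intros -> ->.
  - intros om ga.
    assert (Eom : om = curve_om 1 1).
    { apply functional_extensionality. intros t. unfold om, curve_om. field. }
    assert (Ega : ga = curve_ga 1 1).
    { apply functional_extensionality. intros t. unfold ga, curve_ga. ring. }
    rewrite Eom, Ega. clear om ga Eom Ega.
    set (u := sqrt 5 / 3).
    assert (S5 : sqrt 5 * sqrt 5 = 5) by (apply sqrt_sqrt; lra).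
    assert (S50 : 0 < sqrt 5) by (apply sqrt_lt_R0; lra).
    assert (Hu : 0 < u) by (unfold u; lra).
    (* The value 5 / 9 is where [1 / 3 - 3 / 5 * t ^ 2] vanishes and where
       [t ^ 3 <= 5 / 2 * curve_om 1 1 t] becomes an equality. *)
    assert (Huu : u * u = 5 / 9) by (unfold u; nra).
    assert (Ad : admissible 1 1 0 (fun t => 0 < t <= u)).
    { split; [lra|]. split; [unfold curve_om; lra|]. split; [intros; lra|].
      split; [intros; lra|]. intros c t Hc Ht. nra. }
    assert (HA : forall q, R_no 1 1 q <->
              param_curve (curve_om 1 1) (curve_ga 1 1) (fun t => 0 < t <= u) q).
    { intros q. rewrite R_no_focusing by auto. split.
      - intros [t [Ht [-> [Hp Hle]]]]. exists t. split; [|reflexivity].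
        split; [assumption|]. apply Rnot_lt_le. intros Hlt. unfold curve_om in Hle.
        assert (5 / 9 < t ^ 2) by nra.
        assert (5 / 9 * t < t ^ 3) by (replace (t ^ 3) with (t ^ 2 * t) by ring; nra).
        lra.
      - intros [t [Ht ->]]. exists t. split; [apply Ht|]. split; [reflexivity|].
        split; [apply (curve_om_pos _ _ _ _ t Ad Ht)|]. unfold curve_om.
        assert (t ^ 2 <= 5 / 9) by nra.
        assert (t ^ 3 <= 5 / 9 * t) by (replace (t ^ 3) with (t ^ 2 * t) by ring; nra).
        lra. }
    assert (HG : forall p, Gamma_no 1 1 p <->
       param_curve (curve_om 1 1) (curve_ga 1 1) (fun t => 0 < t <= u) p).
    { intros p. apply boundary_of_arc; auto. unfold curve_om. ring. }
    split; [intros p; now rewrite HA, HG|]. split; [exact HG|].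
    split; [|split; [|split; [|split]]].
    + apply filterlim_at_right_continuous; [apply curve_om_continuous|unfold curve_om; ring].
    + apply curve_ga_lim_at_right_0. auto.
    + unfold curve_om. replace (u ^ 3) with (u * u * u) by ring. rewrite Huu. unfold u. field.
    + unfold curve_ga. replace (2 / (3 * u)) with (2 / (u * u) * u / 3) by (field; lra).
      rewrite Huu. unfold u. field.
    + apply negative_slope_ext with (1 := HG). now apply curve_negative_slope with 0.
  - intros om ga.
    assert (Eom : om = curve_om 1 (-1)).
    { apply functional_extensionality. intros t. unfold om, curve_om. field. }
    assert (Ega : ga = curve_ga 1 (-1)).
    { apply functional_extensionality. intros t. unfold ga, curve_ga. ring. }
    rewrite Eom, Ega. clear om ga Eom Ega.
    assert (Ad : admissible 1 (-1) 0 (fun t => 0 < t)).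
    { split; [lra|]. split; [unfold curve_om; lra|]. split; [intros; lra|].
      split; [intros; lra|]. intros c t Hc Ht. nra. }
    destruct (defocusing_region 1 0) as [H1 [H2 H3]]; auto.
    { unfold curve_om. ring. }
    split; [exact H1|]. split; [exact H2|].
    split; [|split; [|split; [|split]]].
    + apply filterlim_at_right_continuous; [apply curve_om_continuous|unfold curve_om; ring].
    + apply curve_ga_lim_at_right_0. auto.
    + apply curve_om_lim_p_infty. auto.
    + apply curve_ga_lim_p_infty. auto.
    + exact H3.
  - assert (Hno : forall p, ~ R_no (-1) 1 p).
    { intros p. rewrite R_no_focusing by auto.
      intros [t [Ht [_ [Hp _]]]]. unfold curve_om in Hp.
      assert (0 < t ^ 3) by now apply pow_lt. lra. }
    split; [exact Hno|]. intros p [_ Hb].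
    destruct (Hb (fun _ => True) (filter_true)) as [[q [_ [_ Hq]]] _].
    now apply (Hno q).
  - intros om ga.
    assert (Eom : om = curve_om (-1) (-1)).
    { apply functional_extensionality. intros t. unfold om, curve_om. field. }
    assert (Ega : ga = curve_ga (-1) (-1)).
    { apply functional_extensionality. intros t. unfold ga, curve_ga, Rdiv. ring. }
    rewrite Eom, Ega. clear om ga Eom Ega.
    set (l := sqrt (5 / 3)).
    assert (Hl : 0 < l) by (apply sqrt_lt_R0; lra).
    assert (Hll : l * l = 5 / 3) by (apply sqrt_sqrt; lra).
    assert (H0 : curve_om (-1) (-1) l = 0).
    { unfold curve_om. replace (l ^ 3) with (l * l * l) by ring. rewrite Hll. field. }
    (* The derivative [- 1 / 3 + 3 / 5 * t ^ 2] changes sign at [t ^ 2 = 5 / 9], well below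
       [l ^ 2 = 5 / 3], so this curve has no cusp. *)
    assert (Ad : admissible (-1) (-1) l (fun t => l < t)).
    { split; [lra|]. split; [lra|]. split; [intros; lra|].
      split; [intros; lra|]. intros c t Hc Ht. nra. }
    destruct (defocusing_region (-1) l) as [H1 [H2 H3]]; auto.
    { intros t Ht Hp. apply Rnot_le_lt. intros Hle. unfold curve_om in Hp.
      assert (t ^ 2 <= 5 / 3) by nra.
      assert (t ^ 3 <= 5 / 3 * t) by (replace (t ^ 3) with (t ^ 2 * t) by ring; nra).
      lra. }
    split; [exact H1|]. split; [exact H2|].
    split; [|split; [|split; [|split]]].
    + apply filterlim_at_right_continuous; [apply curve_om_continuous|exact H0].
    + apply filterlim_at_right_continuous; [now apply curve_ga_continuous|].
      assert (E15 : sqrt 15 = 3 * l).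
      { apply sqrt_lem_1; [lra|lra|]. nra. }
      rewrite E15. unfold curve_ga.
      replace (2 / (3 * l)) with (2 / (l * l) * l / 3) by (field; lra).
      rewrite Hll. field.
    + apply curve_om_lim_p_infty. auto.
    + apply curve_ga_lim_p_infty. auto.
    + exact H3.
Qed.
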